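(* Let $1 < a < d$ be integers. Let $R = k[x^{\alpha}y^{d-\alpha} \mid \alpha \in \{0\} \cup [a,d]]$ and $Q = (x^d,y^d)$. Then $R$ is a Cohen-Macaulay ring and $$\operatorname{reg}(R) = r_Q(R_+) = \left\lceil \frac{d-1}{d-a}\right\rceil.$$
   Context: $k$ is a field and $x,y$ are variables; $[p,q]$ denotes the set of integers $\alpha$ with $p \le \alpha \le q$. $R$ is the $k$-subalgebra of $k[x,y]$ generated by the indicated monomials of degree $d$, graded so that each of these generating monomials has degree $1$: $R = \bigoplus_{n\ge 0} R_n$, and $R_+ = \bigoplus_{n\ge 1} R_n$. $Q$ is the ideal of $R$ generated by $x^d$ and $y^d$. It is a reduction of $R_+$, and $r_Q(R_+)$ is the least integer $r \ge 0$ with $Q(R_+)^r = (R_+)^{r+1}$. $\operatorname{reg}(R)$ is the Castelnuovo-Mumford regularity: write $R$ as a graded quotient of a standard graded polynomial ring $S$ over $k$ (variables mapping to the generating monomials), let $0 \to F_p \to \cdots \to F_0 \to R \to 0$ be a minimal graded free resolution over $S$, let $b_i$ be the maximal degree of the generators of $F_i$; then $\operatorname{reg}(R) = \max\{b_i - i \mid i = 0,\ldots,p\}$. *)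

(* Defs.v *)
From HB Require Import structures.
From mathcomp Require Import all_boot all_order all_algebra.
From mathcomp Require Import mpoly.
From mathcomp Require Import boolp classical_sets.

Set Implicit Arguments.
Unset Strict Implicit.
Unset Printing Implicit Defensive.

Import Order.TTheory GRing.Theory Num.Theory.
Local Open Scope classical_set_scope.
Local Open Scope ring_scope.

Section Ideals.
Variable A : comNzRingType.
Implicit Types (I J P : set A) (s : seq A).

Definition is_ideal I : Prop :=
  [/\ I 0, forall x y, I x -> I y -> I (x + y) & forall c x, I x -> I (c * x)].

Definition ideal_span (E : set A) : set A :=
  [set x | exists (n : nat) (c g : 'I_n -> A),
     (forall i, E (g i)) /\ x = \sum_(i < n) c i * g i].

Definition ideal_mul I J : set A :=
  ideal_span [set z | exists x y, [/\ I x, J y & z = x * y]].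

Definition ideal_pow I (n : nat) : set A := iter n (ideal_mul I) setT.

Definition is_prime P : Prop :=
  [/\ is_ideal P, ~ P 1 & forall x y, P (x * y) -> P x \/ P y].

Definition is_maximal P : Prop :=
  [/\ is_ideal P, ~ P 1 &
      forall J, is_ideal J -> ~ J 1 -> P `<=` J -> J = P].

Definition noetherian : Prop :=
  forall I, is_ideal I -> exists s, I = ideal_span [set x | x \in s].

Definition prime_chain (n : nat) (C : nat -> set A) : Prop :=
  (forall i, (i <= n)%N -> is_prime (C i)) /\
  (forall i, (i < n)%N -> C i `<` C i.+1).

Definition krull_dim (n : nat) : Prop :=
  (exists C, prime_chain n C) /\ (forall m C, prime_chain m C -> (m <= n)%N).

Definition regular_seq s : Prop :=
  (forall i, (i < size s)%N -> forall x,
     ideal_span [set y | y \in take i s] (s`_i * x) ->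
     ideal_span [set y | y \in take i s] x) /\
  ~ ideal_span [set y | y \in s] 1.

Definition depth I (n : nat) : Prop :=
  (exists s, [/\ regular_seq s, (forall x, x \in s -> I x) & size s = n]) /\
  (forall s, regular_seq s -> (forall x, x \in s -> I x) -> (size s <= n)%N).

Definition reduction_number (Q I : set A) (r : nat) : Prop :=
  ideal_mul Q (ideal_pow I r) = ideal_pow I r.+1 /\
  (forall n, ideal_mul Q (ideal_pow I n) = ideal_pow I n.+1 -> (r <= n)%N).

End Ideals.

(* [f] exhibits [L] as the localization of [A] at the prime [P]; this determines
   [L] up to a unique isomorphism over [A]. *)
Definition localization_at (A L : comNzRingType) (P : set A)
    (f : {rmorphism A -> L}) : Prop :=
  [/\ forall s, ~ P s -> exists u, f s * u = 1,
      forall z, exists x s, ~ P s /\ z * f s = f x &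
      forall x, f x = 0 -> exists s, ~ P s /\ s * x = 0].

Definition cohen_macaulay_local (L : comNzRingType) : Prop :=
  exists (M : set L) (n : nat),
    [/\ is_maximal M, (forall J, is_maximal J -> J = M),
        krull_dim L n & depth M n].

Definition cohen_macaulay (A : comNzRingType) : Prop :=
  noetherian A /\
  forall P : set A, is_maximal P ->
    exists (L : comNzRingType) (f : {rmorphism A -> L}),
      localization_at P f /\ cohen_macaulay_local L.

Section Graded.
Variables (k : fieldType) (n : nat) (A : comNzRingType).
Variable pi : {rmorphism {mpoly k[n]} -> A}.
Local Notation S := {mpoly k[n]}.

(* The grading of [A] induced by the standard grading of [S]. *)
Definition graded_piece (e : nat) : set A :=
  [set f | exists2 p : S, p \is e.-homog & f = pi p].

Definition irrelevant_ideal : set A :=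
  [set f | exists (N : nat) (g : nat -> A),
     (forall i, graded_piece i.+1 (g i)) /\ f = \sum_(i < N) g i].

(* Minimal graded free resolutions 0 -> F_p -> ... -> F_0 -> A -> 0 over [S],
   [A] being an [S]-module through [pi]:  F_i is the sum of the
   S(- mgr_deg i j), j < mgr_rank i, its elements are row vectors, and
   F_(i+1) -> F_i is right multiplication by [mgr_diff i].  All F_i with
   i <= p are nonzero and F_i = 0 for i > p = mgr_len.  As A vanishes in
   negative degrees, so do the generators of the F_i. *)
Record minimal_graded_resolution := MinimalGradedResolution {
  mgr_len : nat;
  mgr_rank : nat -> nat;
  mgr_deg : forall i : nat, 'I_(mgr_rank i) -> nat;
  mgr_aug : 'cV[A]_(mgr_rank 0);
  mgr_diff : forall i : nat, 'M[S]_(mgr_rank i.+1, mgr_rank i);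
  mgr_rankP : forall i, (0 < mgr_rank i)%N = (i <= mgr_len)%N;
  mgr_aug_homog : forall j, graded_piece (mgr_deg j) (mgr_aug j 0);
  mgr_diff_homog : forall i u v, mgr_diff i u v != 0 ->
    exists2 e : nat, mgr_deg u = (mgr_deg v + e)%N &
                     mgr_diff i u v \is e.-homog;
  (* F_(i+1) maps into (X_0, ..., X_(n-1)) F_i *)
  mgr_minimal : forall i u v, (mgr_diff i u v)@_0%MM = 0;
  mgr_aug_surj : forall f : A,
    exists w : 'rV[S]_(mgr_rank 0), f = (map_mx pi w *m mgr_aug) 0 0;
  mgr_exact0 : forall w : 'rV[S]_(mgr_rank 0),
    (map_mx pi w *m mgr_aug) 0 0 = 0 <-> exists z, w = z *m mgr_diff 0;
  mgr_exact : forall i (w : 'rV[S]_(mgr_rank i.+1)),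
    w *m mgr_diff i = 0 <-> exists z, w = z *m mgr_diff i.+1
}.

Definition mgr_maxdeg (F : minimal_graded_resolution) (i : nat) : nat :=
  \max_(j < mgr_rank F i) mgr_deg j.

Definition mgr_reg (F : minimal_graded_resolution) : int :=
  \big[Num.max/(mgr_maxdeg F 0)%:Z]_(i < (mgr_len F).+1)
    ((mgr_maxdeg F i)%:Z - i%:Z).

(* Minimal graded free resolutions are unique up to isomorphism, so that [r]
   does not depend on the choice of [F]. *)
Definition regularity (r : int) : Prop :=
  exists F : minimal_graded_resolution, mgr_reg F = r.

End Graded.

Section Subalgebra.
Variables (k : fieldType) (m n : nat) (g : n.-tuple {mpoly k[m]}).

Definition subalg_pred : {pred {mpoly k[m]}} :=
  fun f => `[< exists p : {mpoly k[n]}, f = p \mPo g >].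

Lemma subalg_predP (p : {mpoly k[n]}) : p \mPo g \in subalg_pred.
Proof. by apply/asboolP; exists p. Qed.

Lemma subalg_pred_closed : subring_closed subalg_pred.
Proof.
split=> [|x y /asboolP[p ->] /asboolP[q ->]|x y /asboolP[p ->] /asboolP[q ->]].
- by rewrite -(rmorph1 (comp_mpoly g)) subalg_predP.
- by rewrite -rmorphB subalg_predP.
- by rewrite -rmorphM subalg_predP.
Qed.

HB.instance Definition _ :=
  GRing.isSubringClosed.Build {mpoly k[m]} subalg_pred subalg_pred_closed.

Record subalg :=
  Subalg { subalg_val : {mpoly k[m]}; subalg_valP : subalg_val \in subalg_pred }.

HB.instance Definition _ := [isSub for subalg_val].
HB.instance Definition _ := [Choice of subalg by <:].
HB.instance Definition _ := [SubChoice_isSubComNzRing of subalg by <:].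

Definition subalg_pi (p : {mpoly k[n]}) : subalg := Subalg (subalg_predP p).

Lemma subalg_pi_additive : {morph subalg_pi : p q / p - q}.
Proof. by move=> p q; apply: val_inj; rewrite rmorphB /= rmorphB. Qed.

Lemma subalg_pi_multiplicative : monoid_morphism subalg_pi.
Proof.
split=> [|p q]; apply: val_inj; first by rewrite rmorph1 /= rmorph1.
by rewrite rmorphM /= rmorphM.
Qed.

HB.instance Definition _ :=
  GRing.isZmodMorphism.Build {mpoly k[n]} subalg subalg_pi subalg_pi_additive.
HB.instance Definition _ :=
  GRing.isMonoidMorphism.Build {mpoly k[n]} subalg subalg_pi
    subalg_pi_multiplicative.

End Subalgebra.

Section MonomialCurve.
Variables (k : fieldType) (a d : nat).

Definition xvar : {mpoly k[2]} := 'X_ord0.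
Definition yvar : {mpoly k[2]} := 'X_ord_max.

Definition exponents : seq nat := 0%N :: index_iota a d.+1.

Definition generators : seq {mpoly k[2]} :=
  [seq xvar ^+ alpha * yvar ^+ (d - alpha)%N | alpha <- exponents].

Definition Rring : comNzRingType := subalg (in_tuple generators).

(* The presentation of [Rring] with one variable, of degree 1, for each
   generating monomial. *)
Definition Rpi : {rmorphism {mpoly k[size generators]} -> Rring} :=
  @subalg_pi k 2 _ (in_tuple generators).

Definition Qideal : set Rring :=
  ideal_span [set f : Rring |
    subalg_val f = xvar ^+ d \/ subalg_val f = yvar ^+ d].

Definition Rplus : set Rring := irrelevant_ideal Rpi.

End MonomialCurve.

(* Main.v *)
From HB Require Import structures.
From mathcomp Require Import all_boot all_order all_algebra.
From mathcomp Require Import mpoly.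
From mathcomp Require Import boolp classical_sets.
From mathcomp Require Import perm zify ring.
Require Import Defs.

(* Put c = d - a. A monomial x^al y^be lies in R iff d divides al + be and
   al >= d ceil(v / c) - v, where v = be mod d. Hence R is free over
   k[x^d, y^d] with basis the monomials x^(d ceil(v / c) - v) y^v, v < d, whose
   degrees are ceil(v / c); the largest one is r = ceil((d - 1) / c).

   Regularity. The other c generators of R act on this basis through commuting
   matrices A_i over k[x^d, y^d]. The Koszul complex of the X_i - A_i on S^d is
   a graded free resolution of R; its j-th module has generators in degrees at
   most j + r, and its last one has a generator in degree c + r. Cancelling the
   unit entries makes the resolution minimal, and for degree reasons that
   generator is never cancelled, so reg R = r.

   Reduction number. (R_+)^n is spanned by the monomials of degree at least n.
   Those of degree greater than r are divisible in R by x^d or y^d, and the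
   basis monomial of degree r is not in Q.

   Cohen-Macaulayness. Let P be a maximal ideal. A determinant trick gives
   nonzero f(x^d) and g(y^d) in P; they form a regular sequence in R because
   they are coprime in k[x, y] and R is saturated in k[x, y] with respect to
   polynomials in y^d. A prime containing f(x^d) and avoiding g(y^d) gives a
   chain of length 2 in R_P. Conversely any three elements of the fraction field
   are algebraically dependent over k, and taking lowest coefficients of a
   relation excludes chains of primes and regular sequences of length 3. *)

Set Implicit Arguments.
Unset Strict Implicit.
Unset Printing Implicit Defensive.

Import Order.TTheory GRing.Theory Num.Theory.

(** * Minimal graded free resolutions *)

(** [regularity] asks for an actual minimal resolution, but the Koszul complex is never minimal: R
    is generated over S by 1, while S^d has rank d > 1. The complex is therefore handled as one
    total differential on a subset of a finite basis, from which pairs of generators can be removed.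
    A unit entry joins generators of equal internal degree in consecutive homological degrees, so a
    generator that maximizes both the homological degree and the difference of internal and
    homological degree is in no such pair. The number c of Koszul operators is the number of
    exponents in [a, d - 1].

    For Cohen-Macaulayness, k is arbitrary and P need not be homogeneous; x^d and y^d both lie in P
    only if P = R_+, so the parameters have to depend on P. Their existence is in the spirit of
    Zariski's lemma, with determinants supplying the relations. The upper bounds on dimension and
    depth come from one statement on nested ideals, and the algebraic dependence that feeds it is a
    count of coefficients. *)

Section GradedComplexes.
Local Open Scope ring_scope.

Variables (k : fieldType) (N : nat) (A : comNzRingType).
Variable pi : {rmorphism {mpoly k[N]} -> A}.
Local Notation S := {mpoly k[N]}.
Variables (n : nat) (hd deg : 'I_n -> nat) (eps : 'I_n -> A).
Implicit Types (X : {set 'I_n}) (D : 'I_n -> 'I_n -> S) (w z : 'I_n -> S).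

(* A graded free resolution of [A] given by its total differential: the basis is a
   subset [X] of a fixed finite type, [hd] and [deg] are the homological and internal
   degrees and [eps] is the augmentation. *)
Record graded_res X D : Prop := GradedRes {
  gr_diff : forall x y, D x y != 0 -> hd x = (hd y).+1 /\
    exists2 e : nat, deg x = (deg y + e)%N & D x y \is e.-homog;
  gr_eps : forall x, graded_piece pi (deg x) (eps x);
  gr_eps0 : forall x, hd x != 0%N -> eps x = 0;
  gr_surj : forall f, exists w, f = \sum_(x in X) pi (w x) * eps x;
  gr_sqr : forall x y, x \in X -> y \in X -> \sum_(t in X) D x t * D t y = 0;
  gr_augm : forall x, x \in X -> \sum_(t in X) pi (D x t) * eps t = 0;
  gr_exact : forall w, (forall y, y \in X -> \sum_(x in X) w x * D x y = 0) ->
    \sum_(x in X) pi (w x) * eps x = 0 ->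
    exists z, forall y, y \in X -> w y = \sum_(x in X) z x * D x y }.

Lemma gr_diff0 X D x y : graded_res X D -> hd x != (hd y).+1 -> D x y = 0.
Proof.
by move=> H; apply: contraNeq => /(gr_diff H)[-> _].
Qed.

Lemma sum_setD2 (V : nmodType) X u v (F : 'I_n -> V) :
  u \in X -> v \in X -> u != v ->
  \sum_(x in X) F x = F u + F v + \sum_(x in X :\: [set u; v]) F x.
Proof.
move=> uX vX uv; rewrite (big_setD1 u) //= (big_setD1 v) /=; last first.
  by rewrite !inE eq_sym uv.
by rewrite addrA finset.setDDl.
Qed.

(* Gaussian elimination: the summands at [u] and [v] are split off as a
   contractible subcomplex. *)
Definition cancel_diff D u v x y :=
  D x y - ((D u v)@_0%MM)^-1%:MP * D x v * D u y.

(** Being homogeneous with nonzero constant coefficient, [D u v] is a scalar. Exactness passes to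
    the smaller complex by extending a cycle to [u] and [v], lifting it there, and pushing the lift
    back. *)
Lemma cancel_graded_res X D u v : u \in X -> v \in X -> (D u v)@_0%MM != 0 ->
  graded_res X D -> graded_res (X :\: [set u; v]) (cancel_diff D u v).
Proof.
move=> uX vX c0 H.
have Duv0 : D u v != 0 by apply: contraNneq c0 => ->; rewrite mcoeff0.
have [huv [e0 duv homuv]] := gr_diff H Duv0.
have e0E : e0 = 0%N.
  apply/eqP; apply: contraNT c0 => e00.
  apply/eqP/(dhomog_nemf_coeff homuv); by rewrite mf0 eq_sym.
rewrite e0E addn0 in duv.
have DuvC : D u v = ((D u v)@_0%MM)%:MP.
  apply/mpolyP => m; rewrite mcoeffC; case: eqP => [->|/eqP m0]; first by rewrite mulr1.
  rewrite mulr0; apply: (dhomog_nemf_coeff homuv).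
  by rewrite e0E /= mdeg_eq0.
set c := (D u v)@_0%MM in c0 DuvC.
have kk : c^-1%:MP * D u v = 1 :> S.
  by rewrite DuvC -mpolyCM mulVf.
have uv : u != v by apply/eqP => uv; move: huv; rewrite uv; lia.
have Duu : D u u = 0 by apply: (gr_diff0 H); rewrite huv; lia.
have Dvv : D v v = 0 by apply: (gr_diff0 H); lia.
have epsu : eps u = 0 by apply: (gr_eps0 H); rewrite huv.
have Xsub x : x \in X :\: [set u; v] -> x \in X by case/finset.setDP.
have EX (V : nmodType) (F : 'I_n -> V) := sum_setD2 F uX vX uv.
set X' := X :\: [set u; v] in Xsub EX *.
set D' := cancel_diff D u v.
have D'E x y : D' x y = D x y - c^-1%:MP * D x v * D u y by [].
have sqr x y : x \in X -> y \in X -> \sum_(t in X') D x t * D t y =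
    - (D x u * D u y + D x v * D v y).
  move=> xX yX; apply/eqP; rewrite -addr_eq0 addrC; apply/eqP.
  by rewrite -[RHS](gr_sqr H xX yX) EX.
have sqreps x : x \in X -> \sum_(t in X') pi (D x t) * eps t =
    - (pi (D x v) * eps v).
  move=> xX; apply/eqP; rewrite -addr_eq0 addrC; apply/eqP.
  by rewrite -[RHS](gr_augm H xX) EX epsu mulr0 add0r.
have sumD' w y : \sum_(x in X') w x * D' x y =
    \sum_(x in X') w x * D x y - c^-1%:MP * (\sum_(x in X') w x * D x v) * D u y.
  rewrite mulr_sumr mulr_suml -sumrB; apply: eq_bigr => x _.
  by rewrite D'E mulrBr; congr (_ - _); ring.
have epsD' x : x \in X -> \sum_(t in X') pi (D' x t) * eps t = 0.
  move=> xX; under eq_bigr => t _ do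
    rewrite D'E rmorphB /= mulrBl 2!rmorphM -[X in _ - X]mulrA.
  rewrite sumrB -mulr_sumr !sqreps // mulrN opprK.
  have: pi (c^-1%:MP) * pi (D u v) = 1 by rewrite -rmorphM kk rmorph1.
  move=> E; rewrite mulrACA E mul1r addrC; exact: subrr.
split.
- move=> x y; rewrite D'E => nz.
  have [e1 | nz1] := eqVneq (D x y) 0; last first.
    have [h1 [e d1 hom1]] := gr_diff H nz1; split=> //; exists e => //.
    have [e2|] := eqVneq (D x v) 0; first by rewrite e2 mulr0 mul0r subr0.
    have [e2|] := eqVneq (D u y) 0; first by rewrite e2 mulr0 subr0.
    move=> /(gr_diff H)[_ [ea da ha]] /(gr_diff H)[_ [eb db hb]].
    rewrite rpredB // mul_mpolyC -scalerAl dhomogZ //.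
    have -> : e = (eb + ea)%N by clear -d1 da db duv; lia.
    exact: dhomogM.
  move: nz; rewrite e1 sub0r oppr_eq0 mulf_eq0 negb_or mulf_eq0 negb_or.
  case/andP=> /andP[_ /(gr_diff H)[h1 [eb db hb]]] /(gr_diff H)[h2 [ea da ha]].
  split; first by clear -h1 h2 huv; lia.
  exists (eb + ea)%N; first by clear -da db duv; lia.
  by rewrite mul_mpolyC -scalerAl rpredN dhomogZ // dhomogM.
- exact: gr_eps H.
- exact: gr_eps0 H.
- move=> f; have [w ->] := gr_surj H f.
  exists (fun x => w x - c^-1%:MP * w v * D u x).
  rewrite EX epsu mulr0 add0r.
  under [in RHS]eq_bigr => x _ do rewrite rmorphB /= mulrBl rmorphM -[X in _ - X]mulrA.
  rewrite sumrB -mulr_sumr sqreps // mulrN opprK addrC; congr (_ + _).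
  by rewrite mulrA -rmorphM mulrAC kk mul1r.
- move=> x y xX yX; rewrite sumD'.
  have E y' : y' \in X -> \sum_(t in X') D' x t * D t y' =
      \sum_(t in X') D x t * D t y' - c^-1%:MP * D x v * \sum_(t in X') D u t * D t y'.
    by move=> _; rewrite mulr_sumr -sumrB; apply: eq_bigr => t _; rewrite D'E; ring.
  have [xX1 yX1] := (Xsub _ xX, Xsub _ yX).
  rewrite !E // !sqr // Duu Dvv !mul0r !mulr0 !addr0 !add0r oppr0 mulr0 subr0.
  have -> : c^-1%:MP * - (D x u * D u v) = - D x u.
    by rewrite mulrN mulrCA kk mulr1.
  have -> : c^-1%:MP * D x v * - (D u v * D v y) = - (D x v * D v y).
    by rewrite mulrN -(mul1r (D x v * _)) -kk; congr (- _); ring.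
  by ring.
- by move=> x /Xsub; apply: epsD'.
move=> w wD' weps.
(* The value at [u] is forced by the vanishing of the boundary at [v]; the value at [v] can be taken
   to be 0. *)
pose wu := - (c^-1%:MP * \sum_(x in X') w x * D x v).
pose W x := if x == u then wu else if x == v then 0 else w x.
have Wu : W u = wu by rewrite /W eqxx.
have Wv : W v = 0 by rewrite /W eq_sym (negPf uv) eqxx.
have WX' x : x \in X' -> W x = w x.
  by rewrite !inE negb_or /W => /andP[/andP[/negPf-> /negPf->]].
have EW y : \sum_(x in X) W x * D x y = wu * D u y + \sum_(x in X') w x * D x y.
  rewrite EX Wu Wv mul0r addr0; congr (_ + _).
  by apply: eq_bigr => x /WX'->.
have WDv : \sum_(x in X) W x * D x v = 0.
  by rewrite EW mulNr mulrAC kk mul1r addNr.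
have WDX' y : y \in X' -> \sum_(x in X) W x * D x y = 0.
  by move=> yX; rewrite EW -[RHS](wD' y yX) sumD' addrC mulNr.
(* The boundary is itself killed by [D], its only component left is at [u], and [D u v] is not a
   zero divisor. *)
have WDu : \sum_(x in X) W x * D x u = 0.
  have : \sum_(y in X) (\sum_(x in X) W x * D x y) * D y v = 0.
    under eq_bigr => y _ do rewrite mulr_suml.
    rewrite exchange_big big1 //= => x xX.
    under eq_bigr => y _ do rewrite -mulrA.
    by rewrite -mulr_sumr gr_sqr // mulr0.
  rewrite EX WDv mul0r addr0 [X in _ + X]big1; last first.
    by move=> y /WDX'->; rewrite mul0r.
  by rewrite addr0 => /eqP; rewrite mulf_eq0 (negPf Duv0) orbF => /eqP.
have [||z zP] := gr_exact H (w := W).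
- move=> y yX; have [->//|yu] := eqVneq y u; have [->//|yv] := eqVneq y v.
  by apply: WDX'; rewrite !inE negb_or yu yv.
- rewrite EX Wv epsu mulr0 add0r rmorph0 mul0r add0r -[RHS]weps.
  by apply: eq_bigr => x /WX'->.
(* Row [u] of [D] is a cycle, so a multiple of it may be subtracted from [z]; this one makes the
   component at [v] vanish. *)
exists (fun x => z x - c^-1%:MP * z v * D u x) => y yX'.
have := zP _ vX; rewrite Wv EX Dvv mulr0 addr0 => zv.
have zu : z u = - (c^-1%:MP * \sum_(x in X') z x * D x v).
  move/eqP: zv; rewrite eq_sym addr_eq0 => /eqP zv.
  by rewrite -mulrN -(opprK (\sum_(x in X') _)) -zv opprK mulrCA kk mulr1.
rewrite -WX' // zP ?Xsub // EX zu.
rewrite [RHS](_ : _ = \sum_(x in X') z x * D' x y -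
   c^-1%:MP * z v * \sum_(x in X') D u x * D' x y); last first.
  by rewrite mulr_sumr -sumrB; apply: eq_bigr => x _; rewrite mulrBl mulrA.
have yX := Xsub _ yX'.
rewrite !sumD' !sqr // Duu Dvv !mul0r !mulr0 !addr0 !add0r oppr0 mulr0 mul0r subr0.
have -> : c^-1%:MP * z v * - (D u v * D v y) = - (z v * D v y).
  by rewrite -[z v in RHS]mul1r -kk; ring.
ring.
Qed.

End GradedComplexes.

(** * From a graded resolution to a minimal one *)

Section MinimalResolutions.
Local Open Scope ring_scope.

Variables (k : fieldType) (N : nat) (A : comNzRingType).
Variable pi : {rmorphism {mpoly k[N]} -> A}.
Local Notation S := {mpoly k[N]}.
Variables (n : nat) (hd deg : 'I_n -> nat) (eps : 'I_n -> A).
Local Notation graded_res := (graded_res pi hd deg eps).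

(** Induction on the number of generators. The second hypothesis says that deg - hd is largest at
    [x0], in a form free of subtraction. *)
Lemma minimal_graded_res (x0 : 'I_n) (X : {set 'I_n}) (D : 'I_n -> 'I_n -> S) :
  (forall x, (hd x <= hd x0)%N) ->
  (forall x, (deg x + hd x0 <= hd x + deg x0)%N) ->
  x0 \in X -> graded_res X D ->
  exists (X' : {set 'I_n}) (D' : 'I_n -> 'I_n -> S),
    [/\ x0 \in X', graded_res X' D' &
        forall u v, u \in X' -> v \in X' -> (D' u v)@_0%MM = 0].
Proof.
move=> hd_max deg_max; have [m] := ubnP #|X|.
elim: m => // m IHm in X D * => ltXm x0X resD.
have [/forall_inP minD|] :=
  boolP [forall u in X, forall v in X, (D u v)@_0%MM == 0].
  exists X, D; split=> // u v uX vX; apply/eqP; exact: (forall_inP (minD u uX)).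
rewrite negb_forall_in => /exists_inP[u uX].
rewrite negb_forall_in => /exists_inP[v vX c0].
have Duv0 : D u v != 0 by apply: contraNneq c0 => ->; rewrite mcoeff0.
have [huv [e duv homuv]] := gr_diff resD Duv0.
have e0 : e = 0%N.
  apply/eqP; apply: contraNT c0 => e00.
  by apply/eqP/(dhomog_nemf_coeff homuv); rewrite mf0 eq_sym.
(* [x0 = u] would give [v] a larger deg - hd, and [x0 = v] would give [u] a larger hd. *)
have x0uv : x0 \in X :\: [set u; v].
  have := (hd_max u, hd_max v, deg_max u, deg_max v).
  rewrite !inE x0X andbT negb_or => -[[[h1 h2] h3] h4].
  apply/andP; split; apply/eqP => E; clear -h1 h2 h3 h4 huv duv e0 E; subst; lia.
apply: IHm x0uv (cancel_graded_res uX vX c0 resD).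
have lt2 : (#|X :\: [set u; v]| < #|X|)%N.
  apply/proper_card/properP; split; first exact: subsetDl.
  by exists u => //; rewrite !inE eqxx.
by apply: leq_trans lt2 _.
Qed.

Section FromGradedRes.
Variables (x0 : 'I_n) (X : {set 'I_n}) (D : 'I_n -> 'I_n -> S).
Hypothesis hd_max : forall x, (hd x <= hd x0)%N.
Hypothesis deg_max : forall x, (deg x + hd x0 <= hd x + deg x0)%N.
Hypothesis x0X : x0 \in X.
Hypothesis resD : graded_res X D.
Hypothesis minD : forall u v, u \in X -> v \in X -> (D u v)@_0%MM = 0.

Let Xi (i : nat) := [set x in X | hd x == i].
Let rk (i : nat) := #|Xi i|.
Let bas (i : nat) (j : 'I_(rk i)) : 'I_n := enum_val j.

Let basP i j : (@bas i j \in X) /\ hd (bas j) = i.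
Proof. by have := enum_valP j; rewrite inE => /andP[? /eqP]. Qed.

Let sum_bas i (V : nmodType) (F : 'I_n -> V) :
  (forall x, x \in X -> hd x != i -> F x = 0) ->
  \sum_(x in X) F x = \sum_(j < rk i) F (bas j).
Proof.
move=> F0; rewrite (bigID (fun x => hd x == i)) /= [X in _ + X]big1 ?addr0.
  rewrite -[RHS](big_enum_val F).
  by apply: eq_bigl => x; rewrite inE.
by move=> x /andP[xX]; apply: F0.
Qed.

Let ext i (w : 'rV[S]_(rk i)) x : S := \sum_j w 0 j *+ (bas j == x).

Let ext_bas i (w : 'rV[S]_(rk i)) j : ext w (bas j) = w 0 j.
Proof.
rewrite /ext (bigD1 j) //= eqxx big1 ?addr0 // => j' nj.
by rewrite (inj_eq enum_val_inj) (negPf nj).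
Qed.

Let ext0 i (w : 'rV[S]_(rk i)) x : hd x != i -> ext w x = 0.
Proof.
move=> hx; apply: big1 => j _; case: eqP => // E.
by move: hx; rewrite -E (basP j).2 eqxx.
Qed.

Let dif i : 'M[S]_(rk i.+1, rk i) := \matrix_(u, v) D (bas u) (bas v).
Let aug : 'cV[A]_(rk 0) := \col_j eps (bas j).

Let ext_dif i (w : 'rV[S]_(rk i.+1)) (v : 'I_(rk i)) :
  \sum_(x in X) ext w x * D x (bas v) = (w *m dif i) 0 v.
Proof.
rewrite mxE (sum_bas (i := i.+1)); last by move=> x _ /(ext0 w)->; rewrite mul0r.
by apply: eq_bigr => j _; rewrite ext_bas mxE.
Qed.

Let ext_aug (w : 'rV[S]_(rk 0)) :
  \sum_(x in X) pi (ext w x) * eps x = (map_mx pi w *m aug) 0 0.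
Proof.
rewrite mxE (sum_bas (i := 0)); last first.
  by move=> x _ /(ext0 w)->; rewrite rmorph0 mul0r.
by apply: eq_bigr => j _; rewrite ext_bas !mxE.
Qed.

Let restr i (z : 'I_n -> S) : 'rV[S]_(rk i) := \row_j z (bas j).

Let restr_dif i z (v : 'I_(rk i)) :
  \sum_(x in X) z x * D x (bas v) = (restr i.+1 z *m dif i) 0 v.
Proof.
rewrite mxE (sum_bas (i := i.+1)); first by apply: eq_bigr => j _; rewrite !mxE.
move=> x _ hx; rewrite (gr_diff0 resD) ?mulr0 //.
by rewrite (basP v).2.
Qed.

Let ext_cycle i (w : 'rV[S]_(rk i)) z :
  (forall y, y \in X -> ext w y = \sum_(x in X) z x * D x y) ->
  w = restr i.+1 z *m dif i.
Proof.
move=> E; apply/rowP => v; rewrite -restr_dif -E ?ext_bas //.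
by have [] := basP v.
Qed.

Let dif_sqr i : dif i.+1 *m dif i = 0.
Proof.
apply/matrixP => u v; rewrite !mxE.
rewrite -[RHS](gr_sqr resD (basP u).1 (basP v).1) (sum_bas (i := i.+1)).
  by apply: eq_bigr => j _; rewrite !mxE.
by move=> x _ hx; rewrite (gr_diff0 resD (y := bas v)) ?mulr0 ?(basP v).2.
Qed.

Let dif_aug : map_mx pi (dif 0) *m aug = 0.
Proof.
apply/colP => u; rewrite !mxE -[RHS](gr_augm resD (basP u).1) (sum_bas (i := 0)).
  by apply: eq_bigr => j _; rewrite !mxE.
by move=> x _ hx; rewrite (gr_eps0 resD hx) mulr0.
Qed.

Let exact0 (w : 'rV[S]_(rk 0)) :
  (map_mx pi w *m aug) 0 0 = 0 <-> exists z, w = z *m dif 0.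
Proof.
split=> [wE|[z ->]]; last by rewrite map_mxM -mulmxA dif_aug mulmx0 mxE.
have [||z zE] := gr_exact resD (w := ext w);
  last by exists (restr 1 z); apply: ext_cycle.
- move=> y yX; apply: big1 => x xX; have [h0|/(ext0 w)->] := eqVneq (hd x) 0%N.
    by rewrite (gr_diff0 resD) ?mulr0 // h0.
  by rewrite mul0r.
by rewrite ext_aug.
Qed.

Let exact i (w : 'rV[S]_(rk i.+1)) :
  w *m dif i = 0 <-> exists z, w = z *m dif i.+1.
Proof.
split=> [wE|[z ->]]; last by rewrite -mulmxA dif_sqr mulmx0.
have [||z zE] := gr_exact resD (w := ext w);
  last by exists (restr i.+2 z); apply: ext_cycle.
- move=> y yX; have [hy|hy] := eqVneq (hd y) i; last first.
    apply: big1 => x _; have [hx|/(ext0 w)->] := eqVneq (hd x) i.+1.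
      by rewrite (gr_diff0 resD) ?mulr0 // hx eqSS eq_sym.
    by rewrite mul0r.
  have yXi : y \in Xi i by rewrite inE yX hy eqxx.
  have -> : y = bas (enum_rank_in yXi y) by rewrite /bas enum_rankK_in.
  by rewrite ext_dif wE mxE.
apply: big1 => x _; have [hx|/(ext0 w)->] := eqVneq (hd x) i.+1.
  by rewrite (gr_eps0 resD) ?mulr0 // hx.
by rewrite rmorph0 mul0r.
Qed.

(** There is no gap below [hd x0]: if F_j were zero, exactness would put every basis vector of
    F_(j+1) in the image of a matrix without constant terms, where no component can be 1. *)
Let rk_gt0 i : (0 < rk i)%N = (i <= hd x0)%N.
Proof.
have top : (0 < rk (hd x0))%N by apply/card_gt0P; exists x0; rewrite inE x0X eqxx.
have step j : (0 < rk j.+1)%N -> (0 < rk j)%N.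
  move=> rkj; rewrite lt0n; apply/eqP => rk0; pose j0 : 'I_(rk j.+1) := Ordinal rkj.
  have := exact (delta_mx 0 j0).
  set w := delta_mx 0 _ => -[+ _] => /(_ _)[|z].
    by apply/rowP => v; have := ltn_ord v; rewrite [X in (_ < X)%N]rk0.
  move=> /matrixP/(_ 0 j0).
  rewrite !mxE !eqxx => /(congr1 (mcoeff 0%MM)).
  rewrite mcoeff1 eqxx raddf_sum big1; first by move/eqP; rewrite oner_eq0.
  have mcoeff0M (p q : S) : (p * q)@_0%MM = p@_0%MM * q@_0%MM.
    exact: (rmorphM (mcoeff 0%MM)).
  move=> u _; rewrite mxE [LHS]mcoeff0M minD ?mulr0 //.
    by have [] := basP u.
  by have [] := basP j0.
apply/idP/idP => [/card_gt0P[x]|]; first by rewrite inE => /andP[_ /eqP<-].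
move=> le_i; have : (0 < rk (i + (hd x0 - i)))%N by rewrite subnKC.
elim: (hd x0 - i)%N => [|m IH]; first by rewrite addn0.
by rewrite addnS => /step.
Qed.

Let aug_surj f : exists w : 'rV[S]_(rk 0), f = (map_mx pi w *m aug) 0 0.
Proof.
have [w ->] := gr_surj resD f; exists (restr 0 w).
rewrite mxE (sum_bas (i := 0)); first by apply: eq_bigr => j _; rewrite !mxE.
by move=> x _ hx; rewrite (gr_eps0 resD hx) mulr0.
Qed.

Let dg i (j : 'I_(rk i)) := deg (bas j).

Let aug_homog (j : 'I_(rk 0)) : graded_piece pi (dg j) (aug j 0).
Proof. by rewrite mxE; apply: gr_eps resD _. Qed.

Let dif_homog i u v : dif i u v != 0 ->
  exists2 e : nat, dg u = (dg v + e)%N & dif i u v \is e.-homog.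
Proof. by rewrite mxE => /(gr_diff resD)[]. Qed.

Let dif_minimal i u v : (dif i u v)@_0%MM = 0.
Proof. by rewrite mxE minD //; [have [] := basP u | have [] := basP v]. Qed.

Let F : minimal_graded_resolution pi :=
  MinimalGradedResolution rk_gt0 aug_homog dif_homog dif_minimal aug_surj
    exact0 exact.

Lemma graded_res_regularity (r : nat) : deg x0 = (hd x0 + r)%N ->
  regularity pi r%:Z.
Proof.
move=> degx0; exists F.
have maxdeg_le i : (mgr_maxdeg F i <= i + r)%N.
  apply/bigmax_leqP => /= j _; rewrite /dg.
  by have := deg_max (bas j); rewrite (basP j).2 degx0; lia.
apply/eqP; rewrite eq_le; apply/andP; split.
  apply: bigmax_le => [|i _]; have := maxdeg_le 0%N; first by lia.
  by move=> _; have := maxdeg_le i; lia.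
have x0Xi : x0 \in Xi (hd x0) by rewrite inE x0X eqxx.
have : (hd x0 + r <= mgr_maxdeg F (hd x0))%N.
  rewrite -degx0; have -> : deg x0 = dg (enum_rank_in x0Xi x0).
    by rewrite /dg /bas enum_rankK_in.
  exact: (@leq_bigmax _ (fun j : 'I_(rk (hd x0)) => dg j)).
move=> h; apply: le_trans (le_bigmax _ _ (@ord_max (hd x0))); rewrite /=.
by lia.
Qed.

End FromGradedRes.

Theorem regularity_of_graded_res (x0 : 'I_n) (D : 'I_n -> 'I_n -> S) (r : nat) :
  (forall x, (hd x <= hd x0)%N) -> (forall x, (deg x <= hd x + r)%N) ->
  deg x0 = (hd x0 + r)%N -> graded_res (finset.setTfor _) D -> regularity pi r%:Z.
Proof.
move=> hd_max deg_le degx0 resD.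
have deg_max x : (deg x + hd x0 <= hd x + deg x0)%N.
  by have := deg_le x; rewrite degx0; lia.
have [X [D' [x0X resD' minD]]] :=
  minimal_graded_res hd_max deg_max (finset.in_setT x0) resD.
exact: graded_res_regularity hd_max deg_max x0X resD' minD r degx0.
Qed.

End MinimalResolutions.

(** * Koszul complexes *)

Section KoszulComplex.
Local Open Scope ring_scope.

Variables (S : comNzRingType) (d : nat) (I : eqType) (B : I -> 'M[S]_d).
Hypothesis B_comm : forall i j, B i *m B j = B j *m B i.

(** The basis is 2^m copies of ['I_d], arranged as nested sums to fit the blocks of a mapping cone;
    a right-hand choice in [split] means that the corresponding operator occurs in the exterior
    monomial. *)
Fixpoint kos_dim m := if m is m'.+1 then (kos_dim m' + kos_dim m')%N else d.

Fixpoint kos_hd m : 'I_(kos_dim m) -> nat :=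
  if m is m'.+1 then
    fun x => match split x with inl y => kos_hd y | inr y => (kos_hd y).+1 end
  else fun=> 0%N.

Fixpoint kos_base m : 'I_(kos_dim m) -> 'I_d :=
  if m is m'.+1 then
    fun x => match split x with inl y => kos_base y | inr y => kos_base y end
  else id.

Fixpoint kos_top m (v : 'I_d) : 'I_(kos_dim m) :=
  if m is m'.+1 then rshift (kos_dim m') (kos_top m' v) else v.

Fixpoint kos_diag m (M : 'M[S]_d) : 'M[S]_(kos_dim m) :=
  if m is m'.+1 then block_mx (kos_diag m' M) 0 0 (kos_diag m' M) else M.

(* The total complex of the iterated mapping cones of [B i], [i] in [s], on the
   free module of row vectors of length [d]. *)
Fixpoint kos s : 'M[S]_(kos_dim (size s)) :=
  if s is i :: s' then block_mx (kos s') 0 (kos_diag (size s') (B i)) (- kos s')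
  else 0.

(** Inclusion of the part of homological degree 0; its transpose is the projection onto that
    part. *)
Fixpoint kos_in m : 'M[S]_(d, kos_dim m) :=
  if m is m'.+1 then row_mx (kos_in m') 0 else 1%:M.

Lemma kos_hd_le m x : (@kos_hd m x <= m)%N.
Proof.
elim: m x => //= m IHm x; case: (split x) => y; have := IHm y; lia.
Qed.

Lemma kos_hd_top m v : kos_hd (kos_top m v) = m.
Proof.
elim: m => //= m IHm; case: split_ordP => y /eqP; rewrite ?eq_rlshift //.
by rewrite eq_rshift => /eqP <-; rewrite IHm.
Qed.

Lemma kos_base_top m v : kos_base (kos_top m v) = v.
Proof.
elim: m => //= m IHm; case: split_ordP => y /eqP; rewrite ?eq_rlshift //.
by rewrite eq_rshift => /eqP <-.
Qed.

Lemma kos_in_tr m : kos_in m *m (kos_in m)^T = 1%:M.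
Proof.
elim: m => /= [|m IHm]; first by rewrite trmx1 mulmx1.
by rewrite tr_row_mx mul_row_col trmx0 mulmx0 addr0.
Qed.

Lemma kos_diag_in_tr m M : kos_diag m M *m (kos_in m)^T = (kos_in m)^T *m M.
Proof.
elim: m => /= [|m IHm]; first by rewrite trmx1 mul1mx mulmx1.
by rewrite tr_row_mx mul_block_col mul_col_mx trmx0 !mulmx0 !mul0mx !addr0 IHm.
Qed.

Lemma kos_in_kos s : kos_in (size s) *m kos s = 0.
Proof.
elim: s => /= [|i s IHs]; first by rewrite mulmx0.
by rewrite mul_row_block IHs !mulmx0 !mul0mx !addr0 row_mx0.
Qed.

Lemma kos_diag_comm m i j :
  kos_diag m (B i) *m kos_diag m (B j) = kos_diag m (B j) *m kos_diag m (B i).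
Proof.
elim: m => //= m IHm.
by rewrite !mulmx_block !mulmx0 !mul0mx !addr0 !add0r IHm.
Qed.

Lemma kos_diag_kos s i :
  kos_diag (size s) (B i) *m kos s = kos s *m kos_diag (size s) (B i).
Proof.
elim: s => /= [|j s IHs]; first by rewrite mulmx0 mul0mx.
rewrite !mulmx_block !mulmx0 !mul0mx !addr0 !add0r mulmxN mulNmx IHs.
by rewrite kos_diag_comm.
Qed.

Lemma kos_sqr s : kos s *m kos s = 0.
Proof.
elim: s => /= [|i s IHs]; first by rewrite mulmx0.
rewrite mulmx_block !mulmx0 !mul0mx !addr0 !add0r !mulNmx !mulmxN IHs.
by rewrite kos_diag_kos subrr !oppr0 block_mx0.
Qed.

Lemma kos_inE m v x :
  kos_in m v x = ((kos_hd x == 0%N) && (kos_base x == v))%:R.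
Proof.
elim: m x => /= [|m IHm] x; first by rewrite mxE eq_sym.
by rewrite mxE; case: (split x) => y; rewrite ?mxE // IHm.
Qed.

Lemma kos_diag_entry m M x y : kos_diag m M x y != 0 ->
  kos_hd x = kos_hd y /\ kos_diag m M x y = M (kos_base x) (kos_base y).
Proof.
elim: m x y => //= m IHm x y.
rewrite !mxE; case: (split x) => x'; rewrite !mxE; case: (split y) => y';
  rewrite ?mxE ?eqxx //; first exact: IHm.
by move=> /IHm[-> ->].
Qed.

(** This reduces the homogeneity of the total differential to that of the single operators [B i]. *)
Lemma kos_entry s x y : kos s x y != 0 -> kos_hd x = (kos_hd y).+1 /\
  exists2 i, i \in s &
  exists b : bool, kos s x y = (-1) ^+ b * B i (kos_base x) (kos_base y).
Proof.
elim: s x y => /= [|i s IHs] x y; first by rewrite mxE eqxx.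
rewrite !mxE; case: (split x) => x'; rewrite !mxE; case: (split y) => y';
  rewrite ?mxE ?eqxx //.
- move=> /IHs[-> [j js [b ->]]]; split=> //; exists j; first by rewrite inE js orbT.
  by exists b.
- move=> /kos_diag_entry[-> ->]; split=> //; exists i; first by rewrite inE eqxx.
  by exists false; rewrite mul1r.
rewrite oppr_eq0 => /IHs[-> [j js [b ->]]]; split=> //; exists j.
  by rewrite inE js orbT.
by exists (~~ b); case: b; rewrite /= ?expr1 ?expr0 !mulN1r ?opprK // mul1r.
Qed.

(* [K s] plays the role of the submodule generated by the images of the [B i], [i] in
   [s]; regularity of the sequence is [K_reg]. *)
Variable K : seq I -> 'rV[S]_d -> Prop.
Hypothesis K_nil : forall w, K [::] w <-> w = 0.
Hypothesis K_sub : forall s w w', K s w -> K s w' -> K s (w - w').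
Hypothesis K_cons : forall i s w, K s w -> K (i :: s) w.
Hypothesis K_mem : forall i s w, K (i :: s) (w *m B i).
Hypothesis K_reg : forall i s w, i \notin s -> K s (w *m B i) -> K s w.
Hypothesis K_step : forall i s w, i \notin s -> K (i :: s) w ->
  exists h, K s (w - h *m B i).

Let K0 s : K s 0.
Proof. by elim: s => [|i s IHs]; [apply/K_nil | apply: K_cons]. Qed.

Let K_opp s w : K s w -> K s (- w).
Proof. by move=> Kw; rewrite -sub0r; apply: K_sub. Qed.

Let K_add s w w' : K s w -> K s w' -> K s (w + w').
Proof. by move=> Kw /K_opp Kw'; rewrite -(opprK w'); apply: K_sub. Qed.

Lemma kos_boundary s z : K s (z *m kos s *m (kos_in (size s))^T).
Proof.
elim: s z => /= [|i s IHs] z; first by rewrite mulmx0 mul0mx; apply/K_nil.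
rewrite -{1}(hsubmxK z) mul_row_block tr_row_mx mul_row_col trmx0 mulmx0 addr0.
rewrite mulmxDl -[X in _ + X]mulmxA kos_diag_in_tr mulmxA.
by apply: K_add; [apply/K_cons/IHs | apply: K_mem].
Qed.

(** Induction along the mapping cone. For a cycle [row_mx w1 w2], [w2] is a cycle of the smaller
    complex whose degree 0 part is in [K s] by regularity of [B i], so [w2] is a boundary; it
    remains to make [w1] bound after a correction. *)
Lemma kos_exact s w : uniq s -> w *m kos s = 0 ->
  K s (w *m (kos_in (size s))^T) -> exists z, w = z *m kos s.
Proof.
elim: s w => /= [|i s IHs] w.
  by move=> _ _; rewrite trmx1 mulmx1 => /K_nil->; exists 0; rewrite mul0mx.
case/andP=> is_ us; rewrite -(hsubmxK w).
set w1 := lsubmx w; set w2 := rsubmx w.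
rewrite mul_row_block mulmx0 add0r tr_row_mx mul_row_col trmx0 mulmx0 addr0.
rewrite -row_mx0 mulmxN => /eq_row_mx[w12 /eqP]; rewrite oppr_eq0 => /eqP w2c Kw1.
set D := kos s in w12 w2c IHs *; set Phi := kos_diag _ _ in w12 *.
set J := kos_in _ in Kw1 IHs *.
have [z2 z2E] : exists z, w2 = z *m D.
  apply: IHs => //; apply: (K_reg is_).
  rewrite -mulmxA -kos_diag_in_tr mulmxA -[w2 *m _](addKr (w1 *m D)) w12 addr0.
  by rewrite mulNmx; apply/K_opp/kos_boundary.
have [h Kh] := K_step is_ Kw1.
(* [g *m J] has no boundary in the smaller complex, so it leaves [w2] unchanged. With this [g] the
   degree 0 part of the remaining cycle is [w1 *m J^T - h *m B i], which is in [K s]. *)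
pose g := h + z2 *m J^T.
have DPhi : Phi *m D = D *m Phi by apply: kos_diag_kos.
have [||z1 z1E] := IHs (w1 + z2 *m Phi - g *m J *m Phi) us.
- rewrite mulmxBl mulmxDl -[z2 *m _ *m _]mulmxA DPhi mulmxA -z2E w12 sub0r.
  by rewrite -!mulmxA DPhi (mulmxA J) kos_in_kos mul0mx mulmx0 oppr0.
- rewrite mulmxBl mulmxDl -!mulmxA kos_diag_in_tr (mulmxA J) kos_in_tr mul1mx.
  by rewrite !mulmxA mulmxDl opprD addrCA addrK addrC.
exists (row_mx z1 (- z2 + g *m J)).
rewrite mul_row_block mulmx0 add0r mulmxN mulmxDl -z1E.
congr row_mx.
  by rewrite mulNmx [- _ + _]addrC addrA addrNK addrK.
by rewrite mulmxDl mulNmx -z2E -mulmxA kos_in_kos mulmx0 addr0 opprK.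
Qed.

End KoszulComplex.

(** * Regularity from a Koszul resolution *)

Section KoszulResolution.
Local Open Scope ring_scope.

Variables (k : fieldType) (N : nat) (A : comNzRingType).
Variable pi : {rmorphism {mpoly k[N]} -> A}.
Local Notation S := {mpoly k[N]}.
Variables (d : nat) (delta : 'I_d -> nat) (e : 'I_d -> A).
Variables (I : eqType) (B : I -> 'M[S]_d) (K : seq I -> 'rV[S]_d -> Prop).

(** [e] generates A over S and [K s] is the kernel of S^d -> A, so the Koszul complex resolves A.
    Its last generator over an index with [delta v = r] has internal minus homological degree r, the
    largest possible value. *)
Theorem regularity_koszul (s : seq I) (r : nat) :
    (forall v, graded_piece pi (delta v) (e v)) ->
    (forall f, exists w : 'rV_d, f = \sum_v pi (w 0 v) * e v) ->
    (forall i j, B i *m B j = B j *m B i) ->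
    (forall i u v, B i u v != 0 ->
       exists2 f, (delta u).+1 = (delta v + f)%N & B i u v \is f.-homog) ->
    (forall w, K [::] w <-> w = 0) ->
    (forall t w w', K t w -> K t w' -> K t (w - w')) ->
    (forall i t w, K t w -> K (i :: t) w) ->
    (forall i t w, K (i :: t) (w *m B i)) ->
    (forall i t w, i \notin t -> K t (w *m B i) -> K t w) ->
    (forall i t w, i \notin t -> K (i :: t) w -> exists h, K t (w - h *m B i)) ->
    (forall w, K s w <-> \sum_v pi (w 0 v) * e v = 0) ->
    uniq s -> (forall v, (delta v <= r)%N) -> (exists v, delta v = r) ->
  regularity pi r%:Z.
Proof.
move=> e_hom e_span B_comm B_hom K_nil K_sub K_cons K_mem K_reg K_step K_s us.
move=> delta_le [v0 delta_v0].
pose m := size s; pose D := kos B s; pose J := kos_in S d m.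
pose n := kos_dim d m.
pose hd (x : 'I_n) := kos_hd x; pose base (x : 'I_n) := kos_base x.
pose deg x := (hd x + delta (base x))%N.
pose eps x := \sum_v pi (J v x) * e v.
have epsx x : eps x = if hd x == 0%N then e (base x) else 0.
  rewrite /eps; under eq_bigr => v _ do rewrite kos_inE rmorph_nat.
  case: eqP => /= hx; last by apply: big1 => v _; rewrite mul0r.
  rewrite (bigD1 (base x)) //= eqxx mul1r big1 ?addr0 // => v.
  by rewrite eq_sym => /negPf->; rewrite mul0r.
have epsE w : \sum_(x in finset.setTfor _) pi (w x) * eps x =
    \sum_v pi (((\row_x w x) *m J^T) 0 v) * e v.
  rewrite (eq_bigl xpredT) => [|x]; last by rewrite inE.
  under eq_bigr => x _ do rewrite mulr_sumr.
  rewrite exchange_big /=; apply: eq_bigr => v _.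
  rewrite !mxE rmorph_sum mulr_suml; apply: eq_bigr => x _.
  by rewrite !mxE rmorphM mulrA.
have sumD w y : \sum_(x in finset.setTfor _) w x * D x y = ((\row_x w x) *m D) 0 y.
  rewrite (eq_bigl xpredT) => [|x]; last by rewrite inE.
  by rewrite mxE; apply: eq_bigr => x _; rewrite !mxE.
apply: (@regularity_of_graded_res _ _ _ _ n hd deg eps (kos_top m v0) D).
- by move=> x; rewrite /hd kos_hd_top kos_hd_le.
- by move=> x; rewrite leq_add2l.
- by rewrite /deg /base kos_base_top delta_v0.
split.
- move=> x y Dxy; have [hxy [i _ [b DE]]] := kos_entry Dxy; split=> //.
  have B0 : B i (kos_base x) (kos_base y) != 0.
    by apply: contraNneq Dxy => B0; rewrite DE B0 mulr0.
  have [f df hf] := B_hom _ _ _ B0.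
  exists f; first by rewrite /deg /hd /base hxy addSnnS df addnA.
  by rewrite /D DE; case: b {DE}; rewrite ?mul1r // mulN1r rpredN.
- move=> x; rewrite epsx; case: eqP => [hx|_]; last first.
    by exists 0; rewrite ?dhomog0 // rmorph0.
  by rewrite /deg hx; apply: e_hom.
- by move=> x; rewrite epsx => /negPf->.
- move=> f; have [w ->] := e_span f; exists (fun x => (w *m J) 0 x).
  rewrite epsE; apply: eq_bigr => v _; congr (pi (_ 0 v) * _).
  rewrite [\row_x _](_ : _ = w *m J); last by apply/rowP => x; rewrite mxE.
  by rewrite -mulmxA kos_in_tr mulmx1.
- move=> x y _ _; rewrite sumD.
  rewrite [\row_x _](_ : _ = row x D); last by apply/rowP => z; rewrite !mxE.
  by rewrite -row_mul kos_sqr // row0 mxE.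
- move=> x _; rewrite epsE; apply/K_s.
  rewrite [\row_x _](_ : _ = delta_mx 0 x *m D); last first.
    by rewrite -rowE; apply/rowP => z; rewrite !mxE.
  exact: kos_boundary.
move=> w wD weps; rewrite epsE in weps.
have [||z zE] := kos_exact B_comm K_nil K_sub K_cons K_mem K_reg K_step
  (w := \row_x w x) us.
- by apply/rowP => y; rewrite -sumD wD ?mxE // finset.in_setT.
- exact/K_s.
exists (fun x => z 0 x) => y _; rewrite sumD.
rewrite [\row_x _ in RHS](_ : _ = z); last by apply/rowP => x; rewrite mxE.
by rewrite -zE mxE.
Qed.

End KoszulResolution.

(** * The semigroup of monomials of R *)

Section SemigroupArithmetic.
Local Open Scope nat_scope.

(** The ceiling of v / c; it is used through its adjunction with multiplication by [c]. *)
Definition cdiv (v c : nat) := (v + c.-1) %/ c.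

Lemma cdiv_le v c j : 0 < c -> (cdiv v c <= j) = (v <= j * c).
Proof.
move=> c0; rewrite /cdiv -ltnS ltn_divLR // mulSn; lia.
Qed.

Variables (a d : nat).
Hypotheses (ha : 1 < a) (had : a < d).
Local Notation c := (d - a).

Let c_gt0 : 0 < c. Proof. by rewrite subn_gt0. Qed.
Let d_gt0 : 0 < d. Proof. by apply: leq_ltn_trans had. Qed.

(* The exponent of [x] in the generator of [R] over [k[x^d, y^d]] in which the
   exponent of [y] is [v]. *)
Definition base_exp v := d * cdiv v c - v.

Lemma base_expK v : base_exp v + v = d * cdiv v c.
Proof.
rewrite subnK //; have : v <= cdiv v c * c by rewrite -cdiv_le.
by move=> /leq_trans; apply; rewrite mulnC leq_mul2r leq_subr orbT.
Qed.

Definition in_semigroup al be :=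
  (d %| al + be) && (d * cdiv (be %% d) c <= al + be %% d).

(** The witnesses describe a product of generators: [m] factors y^d and [j] others, each of which
    contributes at most c to the exponent of y, and [u] in all. *)
Lemma in_semigroupP al be :
  reflect (exists j m u, [/\ u <= j * c, al + u = j * d & be = m * d + u])
          (in_semigroup al be).
Proof.
apply: (iffP andP) => [[dv le_al]|[j [m [u [uj al_u ->]]]]].
  have /dvdnP[j jE] : d %| al + be %% d.
    move: dv; rewrite {1}(divn_eq be d) addnCA dvdn_addr //.
    by rewrite dvdn_mull.
  exists j, (be %/ d), (be %% d); split; rewrite -?divn_eq //.
  by rewrite -cdiv_le // -(leq_pmul2l d_gt0) [d * j]mulnC -jE.
have -> : al + (m * d + u) = (j + m) * d by rewrite addnCA al_u mulnDl addnC.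
split; first exact: dvdn_mull.
(* With u = l d + v, the l full multiples of d are charged to l of the j factors: c <= d gives v <=
   (j - l) c. *)
rewrite modnMDl; set v := u %% d.
have uE := divn_eq u d; set l := u %/ d in uE.
have lj : l <= j.
  rewrite -(leq_pmul2r d_gt0) -al_u; apply: leq_trans (leq_addl _ _).
  by rewrite [X in _ <= X]uE leq_addr.
have alv : al + v = (j - l) * d by rewrite mulnBl -al_u uE -/v; lia.
rewrite alv mulnC leq_mul2r cdiv_le // mulnBl; apply/orP; right.
rewrite leq_subRL; last by rewrite leq_mul2r lj orbT.
apply: leq_trans uj; rewrite [X in _ <= X]uE -/v leq_add2r.
by rewrite leq_mul2l leq_subr orbT.
Qed.

Lemma in_semigroupD al be al' be' : in_semigroup al be ->
  in_semigroup al' be' -> in_semigroup (al + al') (be + be').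
Proof.
move=> /in_semigroupP[j [m [u [h1 h2 h3]]]] /in_semigroupP[j' [m' [u' [h4 h5 h6]]]].
apply/in_semigroupP; exists (j + j'), (m + m'), (u + u').
by split; rewrite !mulnDl; lia.
Qed.

Lemma in_semigroup_addy al be n : d %| al + be ->
  in_semigroup al (be + n * d) = in_semigroup al be.
Proof.
by move=> dv; rewrite /in_semigroup addnA dvdn_addr ?dvdn_mull ?dv // addnC modnMDl.
Qed.

(** Exponent of x^d when the monomial is written in the basis of R over k[x^d, y^d], the basis index
    being be mod d. The truncated subtraction is exact on the semigroup. *)
Definition coord_x al be := (al + be %% d) %/ d - cdiv (be %% d) c.
Definition coord_y be := be %/ d.

Lemma coordE al be : in_semigroup al be ->
  al = coord_x al be * d + base_exp (be %% d) /\ be = coord_y be * d + be %% d.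
Proof.
move=> /andP[dv le_al]; split; last exact: divn_eq.
apply/eqP; rewrite -(eqn_add2r (be %% d)) -addnA base_expK mulnBl.
have dal : d %| al + be %% d.
  move: dv; rewrite {1}(divn_eq be d) addnCA dvdn_addr //.
  by rewrite dvdn_mull.
by rewrite divnK // [d * _]mulnC subnK // mulnC.
Qed.

Lemma coord_deg al be : in_semigroup al be ->
  al + be = d * (coord_x al be + coord_y be + cdiv (be %% d) c).
Proof.
move=> /coordE[E1 E2].
transitivity (coord_x al be * d + base_exp (be %% d) + (coord_y be * d + be %% d)).
  by rewrite -E1 -E2.
by rewrite addnACA base_expK; ring.
Qed.

Lemma in_semigroup_base v : v < d -> in_semigroup (base_exp v) v.
Proof.
by move=> vd; rewrite /in_semigroup modn_small // base_expK dvdn_mulr /=.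
Qed.

(** Uniqueness of coordinates, hence freeness over k[x^d, y^d]: the exponent of y mod d recovers
    [v]. *)
Lemma base_exp_inj p q v p' q' v' : v < d -> v' < d ->
  p * d + base_exp v = p' * d + base_exp v' -> q * d + v = q' * d + v' ->
  [/\ p = p', q = q' & v = v'].
Proof.
move=> vd vd' + E; have vE : v = v'.
  by have := congr1 (modn^~ d) E; rewrite /= !modnMDl !modn_small.
rewrite -vE in E *; move/addIn: E => /eqP; rewrite eqn_pmul2r // => /eqP <-.
by move/addIn=> /eqP; rewrite eqn_pmul2r // => /eqP.
Qed.

Lemma cdiv_mono v v' : v <= v' -> cdiv v c <= cdiv v' c.
Proof. by move=> le_v; rewrite leq_div2r // leq_add2r. Qed.

End SemigroupArithmetic.

(** * Monomials in two variables *)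

Section Polynomials.
Local Open Scope ring_scope.

Lemma mpoly_rmorph_ext (k : comNzRingType) n (T : comNzRingType)
    (f g : {rmorphism {mpoly k[n]} -> T}) :
  (forall c, f c%:MP = g c%:MP) -> (forall i, f 'X_i = g 'X_i) -> f =1 g.
Proof.
move=> fgC fgX p; rewrite (mpolyE p) !rmorph_sum; apply: eq_bigr => m _ /=.
rewrite -mul_mpolyC !rmorphM fgC mpolyXE_id !rmorph_prod; congr (_ * _).
by apply: eq_bigr => i _; rewrite !rmorphXn fgX.
Qed.

Lemma mpoly_rmorph_exists (k T : comNzRingType) n (u : {rmorphism k -> T})
    (h : 'I_n -> T) : exists f : {rmorphism {mpoly k[n]} -> T},
  (forall x, f x%:MP = u x) /\ (forall i, f 'X_i = h i).
Proof.
exists (mmap u h : {rmorphism _ -> _}); split=> [x|i] /=; first exact: mmapC.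
by rewrite mmapX mmap1U.
Qed.

Lemma mpolyXsubC_reg (C : idomainType) n (i : 'I_n) (c : C) (p : {mpoly C[n]}) :
  ('X_i - c%:MP) * p = 0 -> p = 0.
Proof.
move/eqP; rewrite mulf_eq0 => /orP[/eqP/(congr1 (mcoeff U_(i)%MM))|/eqP//].
rewrite mcoeffB mcoeffC mcoeff0 mcoeffX eqxx mnm1_eq0 mulr0 subr0.
by move/eqP; rewrite oner_eq0.
Qed.

Variable k : comNzRingType.
Local Notation K := {mpoly k[2]}.

Definition mon (i j : nat) : 'X_{1..2} := (U_(ord0) *+ i + U_(ord_max) *+ j)%MM.

Lemma mon0 i j : mon i j ord0 = i.
Proof. by rewrite mnmDE !mulmnE !mnm1E /= mul1n addn0. Qed.

Lemma mon1 i j : mon i j ord_max = j.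
Proof. by rewrite mnmDE !mulmnE !mnm1E /= mul1n. Qed.

Lemma monE (m : 'X_{1..2}) : m = mon (m ord0) (m ord_max).
Proof.
apply/mnmP => i; have [->|->] : i = ord0 \/ i = ord_max; last 2 first.
- by rewrite mon0.
- by rewrite mon1.
by case: i => [[|[|//]] ?]; [left | right]; apply: val_inj.
Qed.

Lemma mon_inj i j i' j' : mon i j = mon i' j' -> i = i' /\ j = j'.
Proof.
move=> E; have E0 := congr1 (fun m : 'X_{1..2} => m ord0) E.
have E1 := congr1 (fun m : 'X_{1..2} => m ord_max) E.
by rewrite /= !mon0 !mon1 in E0 E1.
Qed.

Lemma monD i j i' j' : (mon i j + mon i' j')%MM = mon (i + i') (j + j').
Proof. by rewrite [LHS]monE !(mnmDE _ (mon _ _)) !mon0 !mon1. Qed.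

Lemma mdeg_mon i j : mdeg (mon i j) = (i + j)%N.
Proof. by rewrite mdegD !mdegMn !mdeg1 !mul1n. Qed.

Lemma XmonE i j : 'X_[mon i j] = 'X_ord0 ^+ i * 'X_ord_max ^+ j :> K.
Proof. by rewrite mpolyXD !mpolyXn. Qed.

Lemma XmonM i j i' j' :
  'X_[mon i j] * 'X_[mon i' j'] = 'X_[mon (i + i') (j + j')] :> K.
Proof. by rewrite -mpolyXD monD. Qed.

Lemma XmonX i j n : 'X_[mon i j] ^+ n = 'X_[mon (n * i) (n * j)] :> K.
Proof.
by rewrite mpolyXn; congr 'X_[_]; rewrite [LHS]monE !mulmnE mon0 mon1 ![(_ * n)%N]mulnC.
Qed.

End Polynomials.

Section SubalgInclusion.
Local Open Scope ring_scope.
Variables (k : fieldType) (m n : nat) (g : n.-tuple {mpoly k[m]}).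

Definition subalg_inj : {rmorphism subalg g -> {mpoly k[m]}} :=
  (val : subalg g -> {mpoly k[m]}).

Lemma subalg_injE f : subalg_inj f = subalg_val f. Proof. by []. Qed.

Lemma subalg_inj_inj : injective subalg_inj. Proof. exact: val_inj. Qed.

Lemma subalg_inj_pi p : subalg_inj (subalg_pi g p) = p \mPo g.
Proof. by []. Qed.

End SubalgInclusion.
Arguments subalg_inj {k m n g}.

(** * Membership in R by supports *)

Section Membership.
Local Open Scope ring_scope.

Variables (k : fieldType) (a d : nat).
Hypotheses (ha : (1 < a)%N) (had : (a < d)%N).
Local Notation c := (d - a)%N.
Local Notation K := {mpoly k[2]}.
Local Notation R := (Rring k a d).
Local Notation N := (size (generators k a d)).
Local Notation S := {mpoly k[N]}.
Local Notation g := (in_tuple (generators k a d)).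
Local Notation pi := (Rpi k a d).

Definition gexp (i : nat) := nth 0%N (exponents a d) i.

Lemma tnth_gen (i : 'I_N) : tnth g i = 'X_[mon (gexp i) (d - gexp i)].
Proof.
rewrite (tnth_nth 0) /= (nth_map 0%N) ?XmonE //.
by rewrite -(size_map (fun al => xvar k ^+ al * yvar k ^+ (d - al)%N)).
Qed.

Lemma gexp_mem (i : 'I_N) : gexp i \in exponents a d.
Proof.
by apply: mem_nth; have := ltn_ord i; rewrite [X in (_ < X)%N]size_map.
Qed.

Lemma gexp_le (i : 'I_N) : (gexp i <= d)%N.
Proof.
by have := gexp_mem i; rewrite inE mem_index_iota => /orP[/eqP->|/andP[_]].
Qed.

Lemma gexp_onto al : al \in exponents a d -> exists i : 'I_N, gexp i = al.
Proof.
move=> al_in; have lt : (index al (exponents a d) < N)%N.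
  by rewrite size_map index_mem.
by exists (Ordinal lt); rewrite /gexp nth_index.
Qed.

Lemma gexp_semigroup (i : 'I_N) : in_semigroup a d (gexp i) (d - gexp i).
Proof.
have := gexp_mem i; rewrite inE mem_index_iota => /orP[/eqP->|].
  by apply/(in_semigroupP ha had); exists 0%N, 1%N, 0%N; split; lia.
move=> /andP[h1 h2]; apply/(in_semigroupP ha had).
by exists 1%N, 0%N, (d - gexp i)%N; split; lia.
Qed.

Lemma exists_gen u : (u <= c)%N -> exists i : 'I_N, tnth g i = 'X_[mon (d - u) u].
Proof.
move=> uc; have [|i E] := @gexp_onto (d - u)%N.
  by rewrite inE mem_index_iota; apply/orP; right; lia.
by exists i; rewrite tnth_gen E; congr 'X_[mon _ _]; lia.
Qed.

Lemma exists_geny : exists i : 'I_N, tnth g i = 'X_[mon 0 d].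
Proof.
have [|i E] := @gexp_onto 0%N; first by rewrite inE.
by exists i; rewrite tnth_gen E subn0.
Qed.

(** Powers of y^d are split off; the rest is removed greedily, one generator with y-exponent min(u,
    c) at a time, so that the lift has exactly as many factors as the degree asks for. *)
Lemma monomial_lift n al be : in_semigroup a d al be -> (al + be = d * n)%N ->
  exists2 p : S, p \is n.-homog & p \mPo g = 'X_[mon al be].
Proof.
have d0 : (0 < d)%N by apply: leq_ltn_trans had.
move=> /(in_semigroupP ha had)[j [m [u [uj al_u ->]]]] En.
have {En} -> : n = (j + m)%N.
  by apply/eqP; rewrite -(eqn_pmul2l d0) -En mulnDr; lia.
have [iy Ey] := exists_geny.
have -> : 'X_[mon al (m * d + u)] = 'X_[mon al u] * ('X_[mon 0 d] ^+ m) :> K.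
  by rewrite XmonX XmonM muln0 addn0 addnC.
suff [p hp <-] : exists2 p : S, p \is j.-homog & p \mPo g = 'X_[mon al u].
  exists (p * 'X_iy ^+ m).
    by rewrite dhomogM // mpolyXn dhomogX /= mdegMn mdeg1 mul1n.
  by rewrite rmorphM rmorphXn /= comp_mpolyXU -tnth_nth Ey.
elim: j u al uj al_u {m} => [|j IHj] u al uj al_u.
  exists 1; first exact: dhomog1.
  have [-> ->] : al = 0%N /\ u = 0%N by lia.
  by rewrite comp_mpoly1 XmonE !expr0 mulr1.
have [i Ei] := exists_gen (geq_minr u c).
have [||p hp Ep] := IHj (u - minn u c)%N (al - (d - minn u c))%N.
- by move: uj; rewrite mulSn; set e := (d - a)%N; lia.
- have := leq_mul (leqnn j) (leq_subr a d); move: uj al_u; rewrite !mulSn.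
  by set e := (d - a)%N; have := leq_subr a d; rewrite -/e; lia.
exists ('X_i * p); first by rewrite -[j.+1]add1n dhomogM // dhomogX /= mdeg1.
have := leq_mul (leqnn j) (leq_subr a d); move: uj al_u; rewrite !mulSn.
rewrite rmorphM /= comp_mpolyXU -tnth_nth Ei Ep XmonM.
have := leq_subr a d; set e := (d - a)%N => h1 h2 h3 h4.
by congr 'X_[mon _ _]; lia.
Qed.

Definition semigroup_supp (p : K) :=
  all (fun m : 'X_{1..2} => in_semigroup a d (m ord0) (m ord_max)) (msupp p).

Lemma semigroup_suppD p q :
  semigroup_supp p -> semigroup_supp q -> semigroup_supp (p + q).
Proof.
move=> /allP hp /allP hq; apply/allP => m /msuppD_le.
by rewrite mem_cat => /orP[/hp|/hq].
Qed.

Lemma semigroup_suppN p : semigroup_supp p -> semigroup_supp (- p).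
Proof. by rewrite /semigroup_supp (perm_all _ (msuppN p)). Qed.

Lemma semigroup_suppM p q :
  semigroup_supp p -> semigroup_supp q -> semigroup_supp (p * q).
Proof.
move=> /allP hp /allP hq; apply/allP => m /msuppM_le/allpairsP[[m1 m2] /= [h1 h2 ->]].
by rewrite !mnmDE; apply: (in_semigroupD ha had); [apply: hp | apply: hq].
Qed.

Lemma semigroup_suppZ x p : semigroup_supp p -> semigroup_supp (x *: p).
Proof. by move=> /allP hp; apply/allP => m /msuppZ_le/hp. Qed.

Lemma semigroup_supp_sum (I : Type) (s : seq I) (P : pred I) (F : I -> K) :
  (forall i, P i -> semigroup_supp (F i)) -> semigroup_supp (\sum_(i <- s | P i) F i).
Proof.
move=> hF; apply: (big_ind (fun p : K => semigroup_supp p)) => //.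
  by rewrite /semigroup_supp -mpolyC0 msupp0.
exact: semigroup_suppD.
Qed.

Lemma semigroup_supp1 : semigroup_supp 1.
Proof.
rewrite /semigroup_supp msupp1 /= andbT !mnm0E.
by apply/(in_semigroupP ha had); exists 0%N, 0%N, 0%N.
Qed.

Lemma semigroup_suppX m :
  semigroup_supp 'X_[m] = in_semigroup a d (m ord0) (m ord_max).
Proof. by rewrite /semigroup_supp msuppX /= andbT. Qed.

(** The generators are monomials, so R is spanned by monomials, and the existential defining
    [subalg_pred] becomes a test on exponents. *)
Lemma subalgE (p : K) : (p \in subalg_pred g) = semigroup_supp p.
Proof.
apply/asboolP/idP => [[q ->]|].
  rewrite comp_mpolyE; apply: semigroup_supp_sum => m _.
  apply: semigroup_suppZ; apply: (big_ind (fun p : K => semigroup_supp p)) => [||i _].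
  - exact: semigroup_supp1.
  - exact: semigroup_suppM.
  elim: (m i) => [|n IHn]; first exact: semigroup_supp1.
  rewrite exprS semigroup_suppM // tnth_gen semigroup_suppX mon0 mon1.
  exact: gexp_semigroup.
move=> /allP hp; rewrite (mpolyE p).
pose P q := exists r : S, q = r \mPo g.
rewrite big_seq; apply: (big_ind P) => [|_ _ [q ->] [q' ->]|m /hp hm].
- by exists 0; rewrite rmorph0.
- by exists (q + q'); rewrite rmorphD.
have /dvdnP[n nE] : (d %| m ord0 + m ord_max)%N by case/andP: hm.
rewrite mulnC in nE.
have [r _ rE] := monomial_lift hm nE.
by exists (p@_m *: r); rewrite comp_mpolyZ rE -monE.
Qed.

Lemma valR_supp (f : R) : semigroup_supp (subalg_val f).
Proof. by rewrite -subalgE subalg_valP. Qed.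

End Membership.

(** * The Koszul resolution of R *)

Section Regularity.
Local Open Scope ring_scope.

Variables (k : fieldType) (a d : nat).
Hypotheses (ha : (1 < a)%N) (had : (a < d)%N).
Local Notation c := (d - a)%N.
Local Notation K := {mpoly k[2]}.
Variables (N : nat) (g : N.-tuple K) (gexp : 'I_N -> nat).
Local Notation S := {mpoly k[N]}.
Local Notation P := {mpoly K[N]}.
Hypothesis gE : forall i, tnth g i = 'X_[mon (gexp i) (d - gexp i)].
Hypothesis gexp_semigroup : forall i, in_semigroup a d (gexp i) (d - gexp i).
Local Notation base_exp := (base_exp a d).

Variables iz iw : 'I_N.
Hypothesis izE : tnth g iz = 'X_[mon d 0].
Hypothesis iwE : tnth g iw = 'X_[mon 0 d].

Let d_gt0 : (0 < d)%N. Proof. by apply: leq_ltn_trans had. Qed.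

Let iz_iw : iz != iw.
Proof.
apply/eqP => E; move: izE; rewrite E iwE => /(congr1 (@msupp 2 k)).
rewrite !msuppX => /(congr1 (head 0%MM))/mon_inj[E0 _].
by move: d_gt0; rewrite -E0.
Qed.

Definition base_elt (v : 'I_d) : K := 'X_[mon (base_exp v) v].

Definition mul_al (i : 'I_N) (u : 'I_d) := (gexp i + base_exp u)%N.
Definition mul_be (i : 'I_N) (u : 'I_d) := (d - gexp i + u)%N.
Definition mul_idx (i : 'I_N) (u : 'I_d) : 'I_d :=
  Ordinal (ltn_pmod (mul_be i u) d_gt0).
Definition mul_coef (i : 'I_N) (u : 'I_d) : S :=
  'X_iz ^+ coord_x a d (mul_al i u) (mul_be i u) * 'X_iw ^+ coord_y d (mul_be i u).

(* Multiplication by [tnth g i] in the basis [base_elt] of [R] over [k[x^d, y^d]],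
   acting on row vectors. *)
Definition mul_mx (i : 'I_N) : 'M[S]_d :=
  \matrix_(u, v) (if v == mul_idx i u then mul_coef i u else 0).

Definition kos_mx (i : 'I_N) : 'M[S]_d := ('X_i)%:M - mul_mx i.

Let mul_semigroup i u : in_semigroup a d (mul_al i u) (mul_be i u).
Proof.
by apply: (in_semigroupD ha had); [exact: gexp_semigroup | apply: in_semigroup_base].
Qed.

Lemma gen_mul_base i u : tnth g i * base_elt u =
  'X_[mon d 0] ^+ coord_x a d (mul_al i u) (mul_be i u) *
  'X_[mon 0 d] ^+ coord_y d (mul_be i u) * base_elt (mul_idx i u).
Proof.
rewrite gE XmonM !XmonX !XmonM !muln0 addn0 add0n.
by have [<- <-] := coordE had (mul_semigroup i u).
Qed.

(** The degree of the coefficient follows by comparing total degrees in x and y before and after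
    multiplication by [tnth g i], and dividing by d. *)
Lemma kos_mx_homog i u v : (gexp i <= d)%N -> kos_mx i u v != 0 ->
  exists2 f, (cdiv u c).+1 = (cdiv v c + f)%N & kos_mx i u v \is f.-homog.
Proof.
move=> gd; rewrite !mxE; have [vE _|vE] := eqVneq v (mul_idx i u); last first.
  rewrite subr0; case: (u =P v) => [-> _|_]; last by rewrite eqxx.
  by exists 1%N; rewrite ?addn1 // dhomogX /= mdeg1.
pose f := (coord_x a d (mul_al i u) (mul_be i u) + coord_y d (mul_be i u))%N.
have fE : (cdiv u c).+1 = (cdiv v c + f)%N.
  apply/eqP; rewrite -(eqn_pmul2l d_gt0) addnC vE /=.
  rewrite -(coord_deg had (mul_semigroup i u)) /mul_al /mul_be.
  have := base_expK had u; rewrite mulnS => E; apply/eqP; rewrite -E.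
  by move: (base_exp u) => bu; clear E; lia.
exists f => //; apply: rpredB; last first.
  by rewrite dhomogM // mpolyXn dhomogX /= mdegMn mdeg1 mul1n.
move: fE; case: (u =P v) => [-> /eqP|_ _]; last by rewrite mulr0n dhomog0.
by rewrite -addn1 eqn_add2l => /eqP <-; rewrite dhomogX /= mdeg1.
Qed.

Definition mid := {i : 'I_N | (i != iz) && (i != iw)}.
Implicit Types (t : seq mid).

(* [ev t] replaces ['X_i] by its value [tnth g i] for [i = iz], [i = iw] and [i] in
   [t], and keeps the other variables. The kernel of [evs t] is then the submodule
   generated by the images of the [kos_mx i], [i] in [t], and ['X_i - tnth g i] being a
   nonzero element of a domain makes [kos_mx i] regular modulo it. *)
Definition evaluated t (i : 'I_N) := [|| i == iz, i == iw | i \in map val t].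

Definition ev_var t i : P := if evaluated t i then (tnth g i)%:MP else 'X_i.

Variable ev : seq mid -> {rmorphism S -> P}.
Hypothesis evC : forall t x, ev t x%:MP = x%:MP%:MP.
Hypothesis evX : forall t i, ev t 'X_i = ev_var t i.

Lemma ev_coef t i u : ev t (mul_coef i u) =
  ('X_[mon d 0] ^+ coord_x a d (mul_al i u) (mul_be i u) *
  'X_[mon 0 d] ^+ coord_y d (mul_be i u))%:MP.
Proof.
rewrite rmorphM !rmorphXn !evX /ev_var /evaluated !eqxx orbT /= izE iwE.
by rewrite -!rmorphXn -rmorphM.
Qed.

Definition evs t (w : 'rV[S]_d) : P := \sum_v ev t (w 0 v) * (base_elt v)%:MP.

Lemma evsB t w w' : evs t (w - w') = evs t w - evs t w'.
Proof.
by rewrite -sumrB; apply: eq_bigr => v _; rewrite !mxE rmorphB mulrBl.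
Qed.

Lemma evsD t w w' : evs t (w + w') = evs t w + evs t w'.
Proof.
by rewrite -big_split; apply: eq_bigr => v _; rewrite !mxE rmorphD mulrDl.
Qed.

Lemma evsZ t p w : evs t (p *: w) = ev t p * evs t w.
Proof.
by rewrite mulr_sumr; apply: eq_bigr => v _; rewrite !mxE rmorphM mulrA.
Qed.

Lemma evs_mul t i w : evs t (w *m mul_mx i) = (tnth g i)%:MP * evs t w.
Proof.
rewrite /evs; under eq_bigr => v _ do rewrite mxE rmorph_sum mulr_suml.
rewrite exchange_big mulr_sumr; apply: eq_bigr => u _ /=.
rewrite (bigD1 (mul_idx i u)) //= big1 ?addr0 => [|v /negPf nv].
  rewrite mxE eqxx rmorphM ev_coef -mulrA -mpolyCM -gen_mul_base mpolyCM.
  by rewrite mulrCA.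
by rewrite mxE nv mulr0 rmorph0 mul0r.
Qed.

Lemma evs_kos t i w :
  evs t (w *m kos_mx i) = (ev_var t i - (tnth g i)%:MP) * evs t w.
Proof.
by rewrite mulmxBr evsB evs_mul mul_mx_scalar evsZ evX mulrBl.
Qed.

Definition reset (m : 'X_{1..N}) : 'X_{1..N} :=
  [multinom if (i == iz) || (i == iw) then 0%N else m i | i < N].

Lemma ev_nilX (m : 'X_{1..N}) :
  ev [::] 'X_[m] = 'X_[mon (m iz * d) (m iw * d)]%:MP * 'X_[reset m].
Proof.
rewrite mpolyXE_id rmorph_prod (bigD1 iz) //= (bigD1 iw) /=; last by rewrite eq_sym.
rewrite !rmorphXn !evX /ev_var /evaluated !eqxx orbT /= izE iwE.
rewrite mulrA -!rmorphXn -rmorphM !XmonX XmonM !muln0 addn0 add0n.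
congr (_ * _); rewrite mpolyXE_id [RHS](bigD1 iz) //= [in RHS](bigD1 iw) /=;
  last by rewrite eq_sym.
rewrite !mnmE !eqxx orbT !expr0 !mul1r; apply: eq_bigr => i /andP[n1 n2].
rewrite rmorphXn evX /ev_var /evaluated mnmE.
by rewrite (negPf n1) (negPf n2).
Qed.

(** Distinct pairs of a monomial of S and a basis index have distinct images in K[X]: [base_exp_inj]
    separates the exponents of x and y, [reset] the remaining variables. So every coefficient of [w]
    can be read off. *)
Lemma evs_nil_coef w (v : 'I_d) (m : 'X_{1..N}) :
  (evs [::] w)@_(reset m)@_(mon (m iz * d + base_exp v) (m iw * d + v)) =
  (w 0 v)@_m.
Proof.
pose al := (m iz * d + base_exp v)%N; pose be := (m iw * d + v)%N.
have term (p : S) v' : (ev [::] p * (base_elt v')%:MP)@_(reset m)@_(mon al be) =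
    if v' == v then p@_m else 0.
  rewrite {1}(mpolyE p) rmorph_sum mulr_suml !raddf_sum /=.
  transitivity (\sum_(m' <- msupp p) p@_m' * ((m' == m) && (v' == v))%:R).
    apply: eq_bigr => m' _; rewrite -mul_mpolyC rmorphM evC ev_nilX.
    rewrite -!mulrA [_ * (base_elt v')%:MP]mulrC !mulrA -!mpolyCM.
    rewrite mcoeffCM mcoeffX mulr_natr mcoeffMn -mulrA mcoeffCM XmonM mcoeffX.
    have -> : ((m' == m) && (v' == v)) = (reset m' == reset m) &&
        (mon (m' iz * d + base_exp v') (m' iw * d + v') == mon al be).
      apply/andP/andP => [[/eqP-> /eqP->] //|[/eqP rE /eqP/mon_inj[]]].
      move=> e1 e2.
      have [h1 h2 /val_inj->] := base_exp_inj had (ltn_ord v') (ltn_ord v) e1 e2.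
      split=> //; apply/eqP/mnmP => i.
      have [->//|n1] := eqVneq i iz; have [->//|n2] := eqVneq i iw.
      have := congr1 (fun mm : 'X_{1..N} => mm i) rE.
      by rewrite /= !mnmE (negPf n1) (negPf n2).
    by case: (reset m' == _); rewrite ?mulr0n ?mulr1n ?mulr0 //=.
  case: eqP => _; last by apply: big1 => m' _; rewrite andbF mulr0.
  have [mp|mp] := boolP (m \in msupp p).
    rewrite (bigD1_seq m) ?msupp_uniq //= eqxx mulr1 big1 ?addr0 //.
    by move=> m' /negPf->; rewrite mulr0.
  rewrite (memN_msupp_eq0 mp) big1_seq // => m' /= m'p.
  by case: (m' =P m) => [E|_]; [rewrite -E m'p in mp | rewrite mulr0].
rewrite /evs !raddf_sum /= (bigD1 v) //= term eqxx big1 ?addr0 // => v' nv.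
by rewrite term (negPf nv).
Qed.

Lemma evs_nil_inj w : evs [::] w = 0 -> w = 0.
Proof.
move=> E; apply/rowP => v; rewrite mxE; apply/mpolyP => m.
by rewrite -evs_nil_coef E !mcoeff0.
Qed.

Lemma evs0 t : evs t 0 = 0.
Proof. by rewrite /evs big1 // => v _; rewrite mxE rmorph0 mul0r. Qed.

(** Under the injective map [evs [::]] both products become multiplications in a commutative
    ring. *)
Lemma kos_mx_comm i j : kos_mx i *m kos_mx j = kos_mx j *m kos_mx i.
Proof.
apply/row_matrixP => u; apply/eqP; rewrite -subr_eq0; apply/eqP.
by apply: evs_nil_inj; rewrite evsB !rowE !mulmxA !evs_kos mulrCA subrr.
Qed.

(** Evaluating one more variable is a ring morphism applied afterwards, so the kernels grow with
    [t]. *)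
Lemma evs_cons i t : exists f : {rmorphism P -> P},
  forall w, evs (i :: t) w = f (evs t w).
Proof.
pose h j : P := if j == val i then (tnth g j)%:MP else 'X_j.
have [f [fC fX]] := mpoly_rmorph_exists (@mpolyC N K) h; exists f => w.
rewrite rmorph_sum; apply: eq_bigr => v _; rewrite rmorphM fC; congr (_ * _).
apply: (mpoly_rmorph_ext (f := ev (i :: t)) (g := f \o ev t)) => [x|j] /=.
  by rewrite !evC fC.
have evaluatedE : evaluated (i :: t) j = evaluated t j || (j == val i).
  rewrite /evaluated /= in_cons.
  by case: (j == iz); case: (j == iw); case: (j == _); case: (j \in _).
rewrite !evX /ev_var evaluatedE; case: (evaluated t j) => /=; first by rewrite fC.
by rewrite fX.
Qed.

Lemma evs_mem i t w : evs (i :: t) (w *m kos_mx (val i)) = 0.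
Proof. by rewrite evs_kos /ev_var /evaluated /= inE eqxx !orbT subrr mul0r. Qed.

Lemma evaluated_mid t (i : mid) : i \notin t -> evaluated t (val i) = false.
Proof.
move=> it; rewrite /evaluated (mem_map val_inj) (negPf it) orbF.
by case/andP: (valP i) => /negPf-> /negPf->.
Qed.

Lemma evs_reg i t w : i \notin t -> evs t (w *m kos_mx (val i)) = 0 -> evs t w = 0.
Proof.
by move=> it; rewrite evs_kos /ev_var evaluated_mid // => /mpolyXsubC_reg.
Qed.

(* The last equation says that ['X_i] can be taken not to occur in [w']. *)
Lemma evs_reduce i t w : i \notin t -> exists w' h,
  w = w' + h *m kos_mx (val i) /\ evs t w' = evs (i :: t) w'.
Proof.
move=> it; pose Q (w : 'rV[S]_d) := exists w' h,
  w = w' + h *m kos_mx (val i) /\ evs t w' = evs (i :: t) w'.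
have Q0 : Q 0 by exists 0, 0; rewrite mul0mx addr0 !evs0.
have QD w1 w2 : Q w1 -> Q w2 -> Q (w1 + w2).
  move=> [w1' [h1 [-> E1]]] [w2' [h2 [-> E2]]]; exists (w1' + w2'), (h1 + h2).
  by rewrite mulmxDl addrACA !evsD E1 E2.
have QZ p w1 : ev t p = ev (i :: t) p -> Q w1 -> Q (p *: w1).
  move=> Ep [w' [h [-> E]]]; exists (p *: w'), (p *: h).
  by rewrite scalerDr scalemxAl !evsZ E Ep.
have evi j : j != val i -> ev t 'X_j = ev (i :: t) 'X_j.
  by move=> /negPf ji; rewrite !evX /ev_var /evaluated /= in_cons ji.
(* For [j = val i], X_j w' differs from [w' *m mul_mx j] by an element of the image of [kos_mx j],
   and the entries of [mul_mx j] involve only X_iz and X_iw. *)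
have QX j w1 : Q w1 -> Q ('X_j *: w1).
  have [->|ji] := eqVneq j (val i); last by apply/QZ/evi.
  move=> [w' [h [-> E]]].
  exists (w' *m mul_mx (val i)), (w' + 'X_(val i) *: h); split.
    rewrite scalerDr mulmxDl -scalemxAl addrA; congr (_ + _).
    by rewrite mulmxBr mul_mx_scalar addrC subrK.
  by rewrite !evs_mul E.
have Qp p w1 : Q w1 -> Q (p *: w1).
  move=> Qw; rewrite (mpolyE p) scaler_suml; apply: (big_ind Q) => // m _.
  rewrite -mul_mpolyC -scalerA; apply: QZ; first by rewrite !evC.
  rewrite mpolyXE_id; elim/big_rec: _ => [|j q _ IH]; first by rewrite scale1r.
  rewrite -scalerA; elim: (m j) => [|n IHn]; first by rewrite expr0 scale1r.
  by rewrite exprS -scalerA; apply: QX.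
rewrite (matrix_sum_delta w) big_ord1; apply: (big_ind Q) => // v _.
apply: Qp; exists (delta_mx 0 v), 0; split; first by rewrite mul0mx addr0.
apply: eq_bigr => v' _; congr (_ * _); rewrite mxE /=.
by case: (v' == v); rewrite ?rmorph1 ?rmorph0.
Qed.

Lemma evs_step i t w : i \notin t -> evs (i :: t) w = 0 ->
  exists h, evs t (w - h *m kos_mx (val i)) = 0.
Proof.
move=> it; have [w' [h [-> E]]] := evs_reduce w it.
rewrite evsD evs_mem addr0 -E => w'0; exists h.
by rewrite addrK.
Qed.

End Regularity.

(** * The regularity of R *)

Section RingRegularity.
Local Open Scope ring_scope.

Variables (k : fieldType) (a d : nat).
Hypotheses (ha : (1 < a)%N) (had : (a < d)%N).
Local Notation c := (d - a)%N.
Local Notation K := {mpoly k[2]}.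
Local Notation R := (Rring k a d).
Local Notation N := (size (generators k a d)).
Local Notation S := {mpoly k[N]}.
Local Notation g := (in_tuple (generators k a d)).
Local Notation pi := (Rpi k a d).

Let d_gt0 : (0 < d)%N. Proof. by apply: leq_ltn_trans had. Qed.

Lemma subalg_base (v : 'I_d) : base_elt k a v \in subalg_pred g.
Proof.
by rewrite (subalgE ha had) semigroup_suppX mon0 mon1 in_semigroup_base.
Qed.

Definition baseR (v : 'I_d) : R := Subalg (subalg_base v).

Lemma semigroup_base_decomp al be : in_semigroup a d al be ->
  exists p q (v : 'I_d), 'X_[mon al be] =
    'X_[mon d 0] ^+ p * 'X_[mon 0 d] ^+ q * base_elt k a v.
Proof.
move=> E; exists (coord_x a d al be), (coord_y d be), (Ordinal (ltn_pmod be d_gt0)).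
rewrite !XmonX !XmonM !muln0 addn0 add0n.
by have [<- <-] := coordE had E.
Qed.

Lemma exists_genx : exists i : 'I_N, tnth g i = 'X_[mon d 0].
Proof.
by have [i iE] := @exists_gen k a d ha had 0 isT; exists i; rewrite iE subn0.
Qed.

Lemma baseR_span (f : R) : exists w : 'rV[S]_d, f = \sum_v pi (w 0 v) * baseR v.
Proof.
have [iz izE] := exists_genx; have [iw iwE] := exists_geny k a d.
pose Q (p : K) := exists w : 'rV[S]_d, p = \sum_v (w 0 v \mPo g) * base_elt k a v.
have [w wE] : Q (subalg_val f).
  have := valR_supp ha had f; move: (subalg_val f) => {f} p /allP hp.
  rewrite (mpolyE p) big_seq; apply: (big_ind Q) => [|_ _ [w ->] [w' ->]|m /hp].
  - by exists 0; rewrite big1 // => v _; rewrite mxE rmorph0 mul0r.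
  - exists (w + w'); rewrite -big_split; apply: eq_bigr => v _.
    by rewrite mxE rmorphD mulrDl.
  move=> /semigroup_base_decomp[u [q [v E]]].
  exists (\row_v' (if v' == v then p@_m *: ('X_iz ^+ u * 'X_iw ^+ q) else 0)).
  rewrite (bigD1 v) //= big1 ?addr0 => [|v' /negPf nv]; last first.
    by rewrite mxE nv rmorph0 mul0r.
  rewrite mxE eqxx comp_mpolyZ rmorphM !rmorphXn /= !comp_mpolyXU -!tnth_nth.
  by rewrite izE iwE -scalerAl -E -monE.
exists w; apply: (@subalg_inj_inj k 2 N g); rewrite subalg_injE wE rmorph_sum.
by apply: eq_bigr => v _; rewrite rmorphM.
Qed.

Theorem regularity_Rring : regularity pi (cdiv d.-1 c)%:Z.
Proof.
have [iz izE] := exists_genx; have [iw iwE] := exists_geny k a d.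
have gE := @tnth_gen k a d; have gS := @gexp_semigroup k a d ha had.
pose mid := mid iz iw.
have evP (t : seq mid) : exists f : {rmorphism S -> {mpoly K[N]}},
    (forall x, f x%:MP = x%:MP%:MP) /\ forall i, f 'X_i = ev_var g t i.
  exact: (mpoly_rmorph_exists (@mpolyC N K \o @mpolyC 2 k)).
pose ev t := sval (cid (evP t)).
have evC t x : ev t x%:MP = x%:MP%:MP by have [] := svalP (cid (evP t)).
have evX t i : ev t 'X_i = ev_var g t i by have [] := svalP (cid (evP t)).
pose Kz t (w : 'rV[S]_d) := evs a ev t w = 0.
pose B (i : mid) := kos_mx k had (gexp a d) iz iw (val i).
apply: (regularity_koszul (delta := fun v : 'I_d => cdiv v c) (e := baseR)
  (B := B) (K := Kz) (s := enum {: mid})).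
- move=> v; have sv := in_semigroup_base had (ltn_ord v).
  have [p hp pE] := monomial_lift k ha had sv (base_expK had v).
  by exists p => //; apply: val_inj.
- exact: baseR_span.
- by move=> i j; exact: (kos_mx_comm ha had gE gS izE iwE evC evX).
- move=> i u v; apply: (kos_mx_homog ha gS izE iwE); exact: gexp_le.
- move=> w; split; first by apply: (evs_nil_inj had izE iwE evC evX).
  by move->; apply: evs0.
- by move=> t w w'; rewrite /Kz evsB => -> ->; rewrite subrr.
- move=> i t w; rewrite /Kz; have [f ->] := evs_cons a d evC evX i t.
  by move->; rewrite rmorph0.
- by move=> i t w; exact: (evs_mem ha had gE gS izE iwE evX).
- by move=> i t w it; exact: (evs_reg ha gE gS izE iwE evX it).
- by move=> i t w it; exact: (evs_step ha had gE gS izE iwE evC evX it).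
- move=> w.
  (* All variables are now evaluated, so [evs] is the augmentation followed by the inclusion of R
     into K[X]. *)
  have evE p : ev (enum {: mid}) p = (p \mPo g)%:MP.
    apply: (mpoly_rmorph_ext (f := ev _)
      (g := @mpolyC N K \o @comp_mpoly N k 2 g)) => [x|i] /=.
      by rewrite evC comp_mpolyC.
    rewrite comp_mpolyXU -tnth_nth evX /ev_var ifT // /evaluated.
    case: eqP => //= /eqP n1; case: eqP => //= /eqP n2.
    have n12 : (i != iz) && (i != iw) by rewrite n1 n2.
    by apply/mapP; exists (Sub i n12); rewrite ?mem_enum.
  have -> : Kz (enum {: mid}) w =
      ((\sum_v (w 0 v \mPo g) * base_elt k a v)%:MP = 0 :> {mpoly K[N]}).
    rewrite /Kz /evs rmorph_sum; congr (_ = _).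
    by apply: eq_bigr => v _; rewrite evE rmorphM.
  have sE : subalg_inj (\sum_v pi (w 0 v) * baseR v) =
      \sum_v (w 0 v \mPo g) * base_elt k a v.
    by rewrite rmorph_sum; apply: eq_bigr => v _; rewrite rmorphM.
  split=> [/eqP|/(congr1 subalg_inj)]; last by rewrite sE rmorph0 => ->.
  rewrite mpolyC_eq0 -sE => /eqP E; apply: subalg_inj_inj.
  by rewrite E rmorph0.
- exact: enum_uniq.
- by move=> v; apply: cdiv_mono; have := ltn_ord v; lia.
have lt : (d.-1 < d)%N by rewrite ltn_predL.
by exists (Ordinal lt).
Qed.

End RingRegularity.

(** * Noetherian rings *)

Section IdealBasics.
Local Open Scope classical_set_scope.
Local Open Scope ring_scope.
Variable A : comNzRingType.
Implicit Types (I J P : set A) (E : set A) (s : seq A).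

Lemma ideal0 I : is_ideal I -> I 0. Proof. by case. Qed.

Lemma idealD I x y : is_ideal I -> I x -> I y -> I (x + y).
Proof. by case=> _ + _; apply. Qed.

Lemma idealMl I c x : is_ideal I -> I x -> I (c * x).
Proof. by case=> _ _; apply. Qed.

Lemma idealMr I c x : is_ideal I -> I x -> I (x * c).
Proof. by rewrite mulrC; apply: idealMl. Qed.

Lemma idealN I x : is_ideal I -> I x -> I (- x).
Proof. by move=> hI Ix; rewrite -mulN1r; apply: idealMl. Qed.

Lemma idealB I x y : is_ideal I -> I x -> I y -> I (x - y).
Proof. by move=> hI Ix Iy; apply: idealD => //; apply: idealN. Qed.

Lemma ideal_sum I (T : Type) (r : seq T) (Q : pred T) (F : T -> A) :
  is_ideal I -> (forall i, Q i -> I (F i)) -> I (\sum_(i <- r | Q i) F i).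
Proof.
move=> hI hF; apply: big_ind => //; first exact: ideal0.
by move=> x y; apply: idealD.
Qed.

Lemma ideal_span_ideal E : is_ideal (ideal_span E).
Proof.
split.
- by exists 0%N, (fun=> 0), (fun=> 0); split=> [[]//|]; rewrite big_ord0.
- move=> x y [n [c [g [hg ->]]]] [n' [c' [g' [hg' ->]]]].
  pose sel (f : 'I_n -> A) (f' : 'I_n' -> A) i :=
    match split i with inl j => f j | inr j => f' j end.
  exists (n + n')%N, (sel c c'), (sel g g'); split.
    by move=> i; rewrite /sel; case: (split i).
  rewrite big_split_ord /=; congr (_ + _); apply: eq_bigr => i _; rewrite /sel.
    by case: split_ordP => j /eqP; rewrite ?eq_lshift ?eq_lrshift // => /eqP ->.
  by case: split_ordP => j /eqP; rewrite ?eq_rlshift ?eq_rshift // => /eqP ->.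
- move=> a x [n [c [g [hg ->]]]]; exists n, (fun i => a * c i), g; split=> //.
  by rewrite mulr_sumr; apply: eq_bigr => i _; rewrite mulrA.
Qed.

Lemma mem_ideal_span E x : E x -> ideal_span E x.
Proof. by move=> Ex; exists 1%N, (fun=> 1), (fun=> x); rewrite big_ord1 mul1r. Qed.

Lemma ideal_span_sub E I : is_ideal I -> E `<=` I -> ideal_span E `<=` I.
Proof.
move=> hI EI x [n [c [g [hg ->]]]]; apply: ideal_sum => // i _.
by apply: idealMl => //; apply: EI.
Qed.

Lemma ideal_span_seq1 (a x : A) :
  ideal_span [set y | y \in [:: a]] x <-> exists c, x = c * a.
Proof.
split=> [|[c ->]]; last first.
  by apply: idealMl; [exact: ideal_span_ideal | apply: mem_ideal_span; rewrite /= inE].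
move: x; apply: (@ideal_span_sub _ [set z | exists c, z = c * a]) => [|y]; last first.
  by rewrite /= inE => /eqP ->; exists 1; rewrite mul1r.
split; first by exists 0; rewrite mul0r.
  by move=> _ _ [c ->] [c' ->]; exists (c + c'); rewrite mulrDl.
by move=> b _ [c ->]; exists (b * c); rewrite mulrA.
Qed.

Lemma ideal_span_nil (x : A) : ideal_span [set y : A | y \in [::]] x -> x = 0.
Proof.
move: x; apply: (@ideal_span_sub _ [set z | z = 0]) => [|y //].
split=> // [_ _ -> ->|c _ ->].
  by rewrite addr0.
by rewrite mulr0.
Qed.

(** Invertibility in the residue field, phrased without a quotient ring: otherwise P + (x) would be
    a larger proper ideal. *)
Lemma maximal_unit P x : is_maximal P -> ~ P x -> exists u, P (x * u - 1).
Proof.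
move=> [hP P1 maxP] nPx.
pose J : set A := [set z | exists p c, P p /\ z = p + c * x].
have hJ : is_ideal J.
  split; first by exists 0, 0; rewrite mul0r addr0; split=> //; apply: ideal0.
    move=> _ _ [p [c [Pp ->]]] [p' [c' [Pp' ->]]]; exists (p + p'), (c + c').
    by split; [apply: idealD | rewrite mulrDl addrACA].
  move=> b _ [p [c [Pp ->]]]; exists (b * p), (b * c).
  by split; [apply: idealMl | rewrite mulrDr mulrA].
have PJ : P `<=` J by move=> p Pp; exists p, 0; rewrite mul0r addr0.
have [[p [c [Pp E]]]|nJ1] := pselect (J 1).
  exists c; rewrite E mulrC opprD addrA addrAC subrr add0r.
  exact: idealN.
case: nPx; rewrite -(maxP J hJ nJ1 PJ); exists 0, 1.
by rewrite add0r mul1r; split=> //; apply: ideal0.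
Qed.

Lemma maximal_prime P : is_maximal P -> is_prime P.
Proof.
move=> mP; have [hP P1 _] := mP; split=> // x y Pxy.
have [|/(maximal_unit mP)[u Pu]] := pselect (P x); [by left | right].
have -> : y = x * y * u - y * (x * u - 1) by ring.
by apply: idealB => //; [apply: idealMr | apply: idealMl].
Qed.

End IdealBasics.

Section HilbertBasis.
Local Open Scope classical_set_scope.
Local Open Scope ring_scope.

Lemma noetherian_field (k : fieldType) : noetherian k.
Proof.
move=> I hI; have [[x [Ix x0]]|noI] := pselect (exists x, I x /\ x != 0).
  exists [:: x]; apply/seteqP; split=> y; last first.
    by move/ideal_span_seq1=> [c ->]; apply: idealMl.
  by move=> _; apply/ideal_span_seq1; exists (y / x); rewrite divfK.
exists [::]; apply/seteqP; split=> y.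
  move=> Iy; have [->|y0] := eqVneq y 0; last by case: noI; exists y.
  exact: (ideal0 (ideal_span_ideal _)).
by move/ideal_span_nil->; apply: ideal0.
Qed.

Lemma noetherian_surj (A B : comNzRingType) (f : {rmorphism A -> B}) :
  (forall y, exists x, y = f x) -> noetherian A -> noetherian B.
Proof.
move=> f_surj noethA I hI; pose J : set A := [set x | I (f x)].
have [|s JE] := noethA J.
  split; first by rewrite /J /= rmorph0; apply: ideal0.
    by move=> x y; rewrite /J /= rmorphD; apply: idealD.
  by move=> c x; rewrite /J /= rmorphM; apply: idealMl.
exists [seq f x | x <- s]; apply/seteqP; split=> y.
  have [x ->] := f_surj y => Ifx; have : J x by [].
  rewrite JE => -[n [c [g [gs ->]]]]; exists n, (f \o c), (f \o g); split.
    by move=> i; apply: map_f; apply: gs.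
  by rewrite rmorph_sum; apply: eq_bigr => i _; rewrite rmorphM.
apply: ideal_span_sub => // _ /mapP[x xs ->].
have : J x by rewrite JE; apply: mem_ideal_span.
by [].
Qed.

(** Hilbert's basis theorem. [L n] collects the coefficients of X^n in the elements of I of degree
    at most n. The union of the chain [L] is finitely generated, so the chain stops at some [D], and
    lifts of generators of L 0, ..., L D generate I. *)
Lemma noetherian_poly (A : comNzRingType) : noetherian A -> noetherian {poly A}.
Proof.
move=> noethA I hI.
pose L n : set A := [set c | exists f, [/\ I f, (size f <= n.+1)%N & f`_n = c]].
have hL n : is_ideal (L n).
  split.
  - by exists 0; rewrite size_poly0 coef0; split=> //; apply: ideal0.
  - move=> _ _ [f [If sf <-]] [g [Ig sg <-]]; exists (f + g); split.
    + exact: idealD.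
    + by rewrite (leq_trans (size_polyD _ _)) // geq_max sf sg.
    + by rewrite coefD.
  - move=> c _ [f [If sf <-]]; exists (c%:P * f); split.
    + exact: idealMl.
    + by rewrite mul_polyC (leq_trans (size_scale_leq _ _)).
    + by rewrite coefCM.
have L_mono n m : (n <= m)%N -> L n `<=` L m.
  move=> nm _ [f [If sf <-]]; exists (f * 'X^(m - n)); split.
  - exact: idealMr.
  - have [->|f0] := eqVneq f 0; first by rewrite mul0r size_poly0.
    by rewrite size_mulXn // -[in leqRHS](subnK nm) -addnS leq_add2l.
  - by rewrite coefMXn ltnNge leq_subr /= subKn.
pose Loo : set A := [set c | exists n, L n c].
have [|soo LooE] := noethA Loo.
  split; first by exists 0%N; apply: ideal0.
    move=> x y [n Lx] [m Ly]; exists (maxn n m); apply: idealD => //.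
      exact: L_mono (leq_maxl _ _) _ Lx.
    exact: L_mono (leq_maxr _ _) _ Ly.
  by move=> c x [n Lx]; exists n; apply: idealMl.
have [D LD] : exists D, forall x, x \in soo -> L D x.
  have: forall x, x \in soo -> Loo x.
    by move=> x xs; rewrite LooE; apply: mem_ideal_span.
  elim: soo {LooE} => [|x s IHs] h; first by exists 0%N.
  have [|D hD] := IHs; first by move=> y ys; apply: h; rewrite inE ys orbT.
  have [n Lx] := h x (mem_head _ _); exists (maxn n D) => y; rewrite inE.
  case/orP => [/eqP->|/hD]; first exact: L_mono (leq_maxl _ _) _ Lx.
  by apply: L_mono; apply: leq_maxr.
have L_le n : L n `<=` L (minn n D).
  move=> c Lc; rewrite /minn; case: ltnP => // _.
  have : Loo c by exists n.
  by rewrite LooE; apply: ideal_span_sub.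
have [s sE] := choice (fun n => noethA (L n) (hL n)).
have /choice[F FE] : forall nc : nat * A, exists f : {poly A}, L nc.1 nc.2 ->
    [/\ I f, (size f <= nc.1.+1)%N & f`_nc.1 = nc.2].
  move=> [n c]; have [[f hf]|nL] := pselect (L n c); first by exists f.
  by exists 0.
pose T := flatten [seq [seq F (n, x) | x <- s n] | n <- iota 0 D.+1].
have FT n x : (n <= D)%N -> x \in s n -> F (n, x) \in T.
  move=> nD xs; apply/flattenP; exists [seq F (n, x) | x <- s n].
    by apply/mapP; exists n => //; rewrite mem_iota.
  exact: map_f.
pose J := ideal_span [set y | y \in T].
have hJ : is_ideal J by apply: ideal_span_ideal.
have TI : [set y | y \in T] `<=` I.
  move=> _ /= /flattenP[_ /mapP[n _ ->] /mapP[x xs ->]].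
  have [] // := FE (n, x); rewrite sE; exact: mem_ideal_span.
have JI : J `<=` I by apply: ideal_span_sub.
have lift n c : (n <= D)%N -> L n c ->
    exists f, [/\ J f, (size f <= n.+1)%N & f`_n = c].
  move=> nD; rewrite {1}sE => -[r [b [g [gs ->]]]].
  have gE i := FE (n, g i).
  have Lg i : L n (g i) by rewrite sE; apply: mem_ideal_span; apply: gs.
  exists (\sum_(i < r) (b i)%:P * F (n, g i)); split.
  - apply: ideal_sum => // i _; apply: idealMl => //; apply: mem_ideal_span.
    by apply: FT => //; apply: gs.
  - apply: (leq_trans (size_sum _ _ _)); apply/bigmax_leqP => i _.
    by rewrite mul_polyC (leq_trans (size_scale_leq _ _)) //; have [] := gE i (Lg i).
  - rewrite coef_sum; apply: eq_bigr => i _; rewrite coefCM.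
    by have [_ _ /= ->] := gE i (Lg i).
exists T; apply/seteqP; split=> f; last exact: JI.
have [m] := ubnP (size f); elim: m f => // m IHm f sf If.
have [f0|/negPf f0] := eqVneq f 0; first by rewrite f0; apply: ideal0.
case: m => [|m] in IHm sf; first by rewrite ltnS leqn0 size_poly_eq0 f0 in sf.
(* Beyond [D] the leading coefficient is realized in degree [D] and shifted by X^(m - D); up to [D]
   the truncated difference is 0. *)
have [||h [Jh sh hE]] := @lift (minn m D) f`_m; first exact: geq_minr.
  by apply: L_le; exists f.
have s_le (n e : nat) : (size h <= n.+1)%N -> (size (h * 'X^e)%R <= (n + e).+1)%N.
  have [->|h0] := eqVneq h 0; first by rewrite mul0r size_poly0.
  by rewrite size_mulXn // addnC -addSn leq_add2r.
have := s_le _ (m - D)%N sh; rewrite minnE subnK ?leq_subr // => sh'.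
pose h' := h * 'X^(m - D); have h'E : h'`_m = f`_m.
  by rewrite coefMXn ltnNge leq_subr /= -minnE.
rewrite -(subrK h' f); apply: idealD => //; last exact: idealMr.
apply: IHm; last by apply: idealB => //; apply: JI; apply: idealMr.
rewrite ltnS; apply/leq_sizeP => j; rewrite leq_eqVlt => /orP[/eqP<-|mj].
  by rewrite coefB h'E subrr.
have sf' : (size f <= j)%N by apply: leq_trans mj; rewrite -ltnS.
by rewrite coefB (nth_default _ sf') (nth_default _ (leq_trans sh' mj)) subrr.
Qed.

(** One polynomial variable is added for each element of [s], with the basis theorem applied each
    time. *)
Lemma noetherian_adjoin (A : comNzRingType) (k : fieldType) (i : {rmorphism k -> A})
    (s : seq A) : exists (B : comNzRingType) (f : {rmorphism B -> A}),
  [/\ noetherian B, forall x, exists b, f b = i x &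
      forall x, x \in s -> exists b, f b = x].
Proof.
elim: s => [|x s [B [f [noethB fi fs]]]].
  by exists k, i; split=> // [|x]; [apply: noetherian_field | exists x].
have cfx : commr_rmorph f x by move=> y; apply: mulrC.
exists {poly B}, (horner_morph cfx); split.
- exact: noetherian_poly.
- by move=> y; have [b <-] := fi y; exists b%:P; rewrite /= horner_morphC.
- move=> y; rewrite inE => /orP[/eqP->|/fs[b <-]].
    by exists 'X; rewrite /= horner_morphX.
  by exists b%:P; rewrite /= horner_morphC.
Qed.

End HilbertBasis.

(** * The reduction number of R *)

Section ReductionNumber.
Local Open Scope classical_set_scope.
Local Open Scope ring_scope.

Variables (k : fieldType) (a d : nat).
Hypotheses (ha : (1 < a)%N) (had : (a < d)%N).
Local Notation c := (d - a)%N.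
Local Notation K := {mpoly k[2]}.
Local Notation R := (Rring k a d).
Local Notation N := (size (generators k a d)).
Local Notation S := {mpoly k[N]}.
Local Notation g := (in_tuple (generators k a d)).
Local Notation pi := (Rpi k a d).

Let d_gt0 : (0 < d)%N. Proof. by apply: leq_ltn_trans had. Qed.

Lemma exists_monR al be : in_semigroup a d al be ->
  exists r : R, subalg_inj r = 'X_[mon al be].
Proof.
move=> E; have mem : 'X_[mon al be] \in subalg_pred g.
  by rewrite (subalgE ha had) semigroup_suppX mon0 mon1.
by exists (Subalg mem).
Qed.

Definition constR : {rmorphism k -> R} := pi \o @mpolyC N k.

Lemma constRE b : subalg_inj (constR b) = b%:MP.
Proof. by rewrite subalg_inj_pi comp_mpolyC. Qed.

(** The terms of an element of R lie in R one by one, because membership depends only on the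
    support. *)
Lemma monomials_ind (Q : R -> Prop) (f : R) :
  Q 0 -> (forall x y, Q x -> Q y -> Q (x + y)) ->
  (forall b m r, m \in msupp (subalg_inj f) ->
     in_semigroup a d (m ord0) (m ord_max) -> subalg_inj r = 'X_[m] ->
     Q (constR b * r)) -> Q f.
Proof.
move=> Q0 QD QM; have fP := allP (valR_supp ha had f).
have /choice[r rP] : forall m : 'X_{1..2}, exists r : R,
    in_semigroup a d (m ord0) (m ord_max) -> subalg_inj r = 'X_[m].
  move=> m; have [E|_] := boolP (in_semigroup _ _ _ _); last by exists 0.
  by have [r rE] := exists_monR E; exists r; rewrite rE -monE.
have -> : f = \sum_(m <- msupp (subalg_inj f)) constR (subalg_inj f)@_m * r m.
  apply: subalg_inj_inj; rewrite rmorph_sum {1}(mpolyE (subalg_inj f)).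
  apply: eq_big_seq => m /fP mf; rewrite rmorphM rP // constRE.
  by rewrite mul_mpolyC.
rewrite big_seq; apply: (big_ind Q Q0 QD) => m mf.
by apply: (QM _ m); rewrite ?rP //; apply: fP.
Qed.

Lemma ideal_monomials (J : set R) (f : R) : is_ideal J ->
  (forall m, m \in msupp (subalg_inj f) -> in_semigroup a d (m ord0) (m ord_max) ->
     exists2 r : R, subalg_inj r = 'X_[m] & J r) -> J f.
Proof.
move=> hJ hm; apply: monomials_ind => [|x y|b m r mf E rE].
- exact: ideal0.
- exact: idealD.
- have [r' r'E Jr'] := hm m mf E; have -> : r = r' by apply: subalg_inj_inj; rewrite rE.
  exact: idealMl.
Qed.

(** Degree n in R is total degree d n in x and y; these ideals turn out to be the powers of R_+. *)
Definition deg_ge (n : nat) : set R :=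
  [set f : R | forall m, m \in msupp (subalg_inj f) -> (d * n <= mdeg m)%N].

Lemma deg_ge_ideal n : is_ideal (deg_ge n).
Proof.
split=> [m|f f' hf hf' m|f f' hf m].
- by rewrite rmorph0 -mpolyC0 msupp0.
- by rewrite rmorphD => /msuppD_le; rewrite mem_cat => /orP[/hf|/hf'].
- rewrite rmorphM => /msuppM_le/allpairsP[[m1 m2] /= [_ /hf h ->]].
  by rewrite mdegD (leq_trans h) // leq_addl.
Qed.

Lemma deg_geM n n' f f' : deg_ge n f -> deg_ge n' f' -> deg_ge (n + n')%N (f * f').
Proof.
move=> hf hf' m; rewrite rmorphM => /msuppM_le/allpairsP[[m1 m2] /=].
move=> [/hf h1 /hf' h2 ->].
by rewrite mdegD mulnDr leq_add.
Qed.

Lemma graded_piece_homog e f : graded_piece pi e f -> subalg_inj f \is (d * e).-homog.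
Proof.
move=> [p hp ->]; rewrite subalg_inj_pi comp_mpolyE.
rewrite big_seq; apply: rpred_sum => m mp; apply: dhomogZ.
have /dhomogP/(_ m mp) /= <- := hp; rewrite mdegE big_distrr /=.
apply: (big_ind2 (fun (q : K) n => q \is n.-homog)) => [||i _].
- exact: dhomog1.
- by move=> q n q' n'; apply: dhomogM.
rewrite tnth_gen mpolyXn dhomogX /= mdegMn mdeg_mon subnKC //.
exact: gexp_le.
Qed.

Lemma Rplus_deg_ge f : @Rplus k a d f -> deg_ge 1 f.
Proof.
move=> [n [h [hh ->]]]; apply: ideal_sum => [|i _]; first exact: deg_ge_ideal.
move=> m mh; have /dhomogP/(_ m mh) /= -> := graded_piece_homog (hh i).
by rewrite leq_mul2l orbT.
Qed.

Lemma gen_Rplus (i : 'I_N) (r : R) : subalg_inj r = tnth g i -> @Rplus k a d r.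
Proof.
move=> rE; exists 1%N, (fun j => if j == 0%N then r else 0); split; last first.
  by rewrite big_ord1.
move=> [|j] /=; last by exists 0; rewrite ?dhomog0 ?rmorph0.
exists 'X_i; first by rewrite dhomogX /= mdeg1.
by apply: subalg_inj_inj; rewrite rE subalg_inj_pi comp_mpolyXU -tnth_nth.
Qed.

Lemma semigroup_split al be : in_semigroup a d al be -> (0 < al + be)%N ->
  exists (i : 'I_N) al' be' al0 be0, [/\ tnth g i = 'X_[mon al0 be0],
    in_semigroup a d al0 be0 && in_semigroup a d al' be', (al0 + be0 = d)%N &
    al = (al0 + al')%N /\ be = (be0 + be')%N].
Proof.
move=> /(in_semigroupP ha had)[j [m [u [uj al_u ->]]]] pos.
case: m => [|m] in pos *; last first.
  have [i iE] := exists_geny k a d; exists i, al, (m * d + u)%N, 0%N, d.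
  split=> //; last by rewrite mulSn -addnA.
  apply/andP; split; apply/(in_semigroupP ha had); last by exists j, m, u.
  by exists 0%N, 1%N, 0%N; split; lia.
case: j => [|j] in uj al_u.
  by move: pos; rewrite mul0n in uj al_u; lia.
have [i iE] := exists_gen k ha had (geq_minr u c).
have hm := leq_mul (leqnn j) (leq_subr a d); have hc := leq_subr a d.
exists i, (al - (d - minn u c))%N, (u - minn u c)%N, (d - minn u c)%N, (minn u c).
move: uj al_u; rewrite !mulSn; move: hm hc; set e := (d - a)%N => hm hc uj al_u.
split=> //; last 1 first.
- by split; lia.
- apply/andP; split; apply/(in_semigroupP ha had); rewrite -/e.
    by exists 1%N, 0%N, (minn u e); split; lia.
  by exists j, 0%N, (u - minn u e)%N; split; lia.
- lia.
Qed.

Lemma ideal_powS_ideal (I : set R) n : is_ideal (ideal_pow I n).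
Proof.
by case: n => [|n]; [split | exact: ideal_span_ideal].
Qed.

Lemma monR_pow n (r : R) al be : subalg_inj r = 'X_[mon al be] ->
  in_semigroup a d al be -> (d * n <= al + be)%N -> ideal_pow (@Rplus k a d) n r.
Proof.
elim: n r al be => // n IHn r al be rE E le_n.
have pos : (0 < al + be)%N by apply: leq_trans le_n; rewrite muln_gt0 d_gt0.
have [i [al' [be' [al0 [be0 [iE /andP[E0 E'] ddE [alE beE]]]]]]] :=
  semigroup_split E pos.
have [r0 r0E] := exists_monR E0.
have [r' r'E] := exists_monR E'.
have -> : r = r0 * r'.
  by apply: subalg_inj_inj; rewrite rmorphM r0E r'E XmonM rE alE beE.
apply: mem_ideal_span; exists r0, r'; split=> //.
  by apply: (gen_Rplus (i := i)); rewrite iE.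
apply: (IHn _ al' be') => //.
by move: le_n; rewrite alE beE addnACA ddE mulnS leq_add2l.
Qed.

Lemma Rplus_pow n : ideal_pow (@Rplus k a d) n = deg_ge n.
Proof.
apply/seteqP; split=> f.
  elim: n f => [|n IHn] f; first by move=> _ m _; rewrite muln0.
  apply: ideal_span_sub; first exact: deg_ge_ideal.
  move=> _ [x [y [/Rplus_deg_ge hx /IHn hy ->]]].
  by rewrite -add1n; apply: deg_geM.
move=> hf; apply: ideal_monomials => [|m mf E]; first exact: ideal_powS_ideal.
have [r rE] := exists_monR E; exists r; first by rewrite rE -monE.
by apply: (monR_pow rE E); have := hf m mf; rewrite {1}[m]monE mdeg_mon.
Qed.

(** A basis monomial has degree at most [cdiv d.-1 c], so a larger degree forces a positive exponent
    of x^d or y^d in the coordinates. *)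
Lemma in_semigroup_step al be : in_semigroup a d al be ->
  (d * (cdiv d.-1 c).+1 <= al + be)%N ->
  (in_semigroup a d (al - d) be /\ (d <= al)%N) \/
  (in_semigroup a d al (be - d) /\ (d <= be)%N).
Proof.
move=> E; rewrite (coord_deg had E) leq_pmul2l // => le_r.
have vd : (be %% d < d)%N by rewrite ltn_mod.
have lt_v : (cdiv (be %% d) c <= cdiv d.-1 c)%N by apply: cdiv_mono; lia.
have [alE beE] := coordE had E; have Eb := in_semigroup_base had vd.
case qE : (coord_y d be) => [|q] in le_r beE.
  left; case pE : (coord_x a d al be) => [|p] in le_r alE; first by lia.
  move: (alE); rewrite mulSn -addnA => alE'.
  split; last by rewrite alE' leq_addr.
  have -> : (al - d = p * d + base_exp a d (be %% d))%N by rewrite alE' addKn.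
  have Ep : in_semigroup a d (p * d) 0.
    by apply/(in_semigroupP ha had); exists p, 0%N, 0%N; rewrite !addn0.
  have be_v : (be %% d)%N = be by rewrite [in RHS]beE.
  by have := in_semigroupD ha had Ep Eb; rewrite be_v.
right; move: (beE); rewrite mulSn -addnA => beE'.
split; last by rewrite beE' leq_addr.
rewrite -(in_semigroup_addy _ 1) ?mul1n; last first.
  case/andP: E => dv _; move: dv; rewrite beE' addnCA addKn.
  by rewrite dvdn_addr.
by rewrite subnK // beE' leq_addr.
Qed.

(** The quotient by x^d or y^d has to lie in R: the basis monomial of degree r may well be divisible
    by x^d in k[x, y]. *)
Definition Q_supp : set R := [set f : R |
  forall m : 'X_{1..2}, m \in msupp (subalg_inj f) ->
  (in_semigroup a d (m ord0 - d) (m ord_max) /\ (d <= m ord0)%N) \/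
  (in_semigroup a d (m ord0) (m ord_max - d) /\ (d <= m ord_max)%N)].

Lemma Q_supp_ideal : is_ideal Q_supp.
Proof.
split=> [m|f f' hf hf' m|f f' hf m].
- by rewrite rmorph0 -mpolyC0 msupp0.
- by rewrite rmorphD => /msuppD_le; rewrite mem_cat => /orP[/hf|/hf'].
- rewrite rmorphM => /msuppM_le/allpairsP[[m1 m2] /= [h1 /hf h ->]].
  have E1 := allP (valR_supp ha had f) _ h1.
  rewrite !mnmDE; case: h => -[E2 le_d]; [left | right]; rewrite -addnBA //; split.
  + exact: in_semigroupD.
  + exact: leq_trans (leq_addl _ _).
  + exact: in_semigroupD.
  + exact: leq_trans (leq_addl _ _).
Qed.

Lemma in_semigroup00 : in_semigroup a d 0 0.
Proof. by apply/(in_semigroupP ha had); exists 0%N, 0%N, 0%N. Qed.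

Lemma Qideal_supp : @Qideal k a d `<=` Q_supp.
Proof.
apply: ideal_span_sub => [|f]; first exact: Q_supp_ideal.
have xE : xvar k ^+ d = 'X_[mon d 0] by rewrite XmonE expr0 mulr1.
have yE : yvar k ^+ d = 'X_[mon 0 d] by rewrite XmonE expr0 mul1r.
move=> /= fE m; rewrite subalg_injE.
case: fE => ->; rewrite ?xE ?yE msuppX inE => /eqP->.
  by left; rewrite mon0 mon1 subnn in_semigroup00.
by right; rewrite mon0 mon1 subnn in_semigroup00.
Qed.

Lemma Qideal_mem (f : R) (i j : nat) : subalg_inj f = 'X_[mon i j] ->
  (i = d /\ j = 0%N) \/ (i = 0%N /\ j = d) -> @Qideal k a d f.
Proof.
move=> fE h; apply: mem_ideal_span; rewrite /= -subalg_injE fE XmonE.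
by case: h => -[-> ->]; rewrite expr0 ?mulr1 ?mul1r; [left | right].
Qed.

Theorem reduction_number_Rring :
  reduction_number (@Qideal k a d) (@Rplus k a d) (cdiv d.-1 c).
Proof.
set r := cdiv _ _; have [z zE] : exists z : R, subalg_inj z = 'X_[mon d 0].
  apply: exists_monR; apply/(in_semigroupP ha had).
  by exists 1%N, 0%N, 0%N; split; lia.
have [w wE] : exists w : R, subalg_inj w = 'X_[mon 0 d].
  apply: exists_monR; apply/(in_semigroupP ha had).
  by exists 0%N, 1%N, 0%N; split; lia.
have Qz : Qideal z by apply: (Qideal_mem zE); left.
have Qw : Qideal w by apply: (Qideal_mem wE); right.
split.
  rewrite !Rplus_pow; apply/seteqP; split.
    apply: ideal_span_sub; first exact: deg_ge_ideal.
    move=> _ [x [y [/Qideal_supp Qx hy ->]]]; rewrite -add1n; apply: deg_geM => //.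
    move=> m /Qx; rewrite [m]monE mdeg_mon mon0 mon1 muln1.
    by case=> -[_ /leq_trans]; apply; [apply: leq_addr | apply: leq_addl].
  move=> f hf; apply: ideal_monomials => [|m mf E]; first exact: ideal_span_ideal.
  have := hf m mf; rewrite {1}[m]monE mdeg_mon => le_r.
  have [s sE] := exists_monR E; exists s; first by rewrite sE -monE.
  apply: mem_ideal_span.
  have [[E' le_d]|[E' le_d]] := in_semigroup_step E le_r.
    have [s' s'E] := exists_monR E'; exists z, s'; split=> //.
      move=> m'; rewrite s'E msuppX inE => /eqP->; rewrite mdeg_mon.
      by move: le_r; rewrite mulnS; lia.
    by apply: subalg_inj_inj; rewrite rmorphM zE s'E sE XmonM add0n subnKC.
  have [s' s'E] := exists_monR E'; exists w, s'; split=> //.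
    move=> m'; rewrite s'E msuppX inE => /eqP->; rewrite mdeg_mon.
    by move: le_r; rewrite mulnS; lia.
  by apply: subalg_inj_inj; rewrite rmorphM wE s'E sE XmonM add0n subnKC.
(* If n < r, the basis monomial of index d - 1, of degree r, would lie in R_+^(n+1) = Q R_+^n and
   hence in Q. *)
move=> n; rewrite !Rplus_pow => E; rewrite leqNgt; apply/negP => lt_n.
have ltd : (d.-1 < d)%N by rewrite ltn_predL.
have Etop := in_semigroup_base had ltd.
have [e eE] := exists_monR Etop.
have : deg_ge n.+1 e.
  move=> m; rewrite eE msuppX inE => /eqP->.
  by rewrite mdeg_mon base_expK // leq_pmul2l.
rewrite -E => Qe; have : Q_supp e.
  apply: ideal_span_sub Qe; first exact: Q_supp_ideal.
  move=> _ [x [y [/Qideal_supp Qx _ ->]]].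
  exact: (idealMr y Q_supp_ideal Qx).
move=> /(_ (mon (base_exp a d d.-1) d.-1)); rewrite eE msuppX inE eqxx => /(_ isT).
(* y^d is excluded because d - 1 < d; division by x^d leaves total degree d r - d, below the bound d
   r that the semigroup imposes for v = d - 1. *)
rewrite mon0 mon1; case=> -[]; last by rewrite leqNgt ltd.
case/andP=> _; rewrite modn_small // => h1 h2.
have := base_expK had d.-1; move: h1 h2; rewrite -/r; move: (base_exp _ _ _) => b.
have := leq_mul (leqnn d) lt_n; move: (d * r)%N => dr; lia.
Qed.

End ReductionNumber.

(** * Dimension and depth *)

Section NestedIdeals.
Local Open Scope classical_set_scope.
Local Open Scope ring_scope.

Definition poly_eval (A B : comNzRingType) (h : {rmorphism A -> B}) (x : B) :
  {rmorphism {poly A} -> B} := horner_morph (fun y => mulrC x (h y)).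

Lemma poly_evalE (A B : comNzRingType) (h : {rmorphism A -> B}) x p :
  poly_eval h x p = (map_poly h p).[x].
Proof. by []. Qed.

Lemma poly_evalC (A B : comNzRingType) (h : {rmorphism A -> B}) x c :
  poly_eval h x c%:P = h c.
Proof. by rewrite poly_evalE map_polyC hornerC. Qed.

Lemma poly_evalX (A B : comNzRingType) (h : {rmorphism A -> B}) x :
  poly_eval h x 'X = x.
Proof. by rewrite poly_evalE map_polyX hornerX. Qed.

(* Divide a polynomial relation by the largest possible power of [x]: its lowest
   coefficient then lies in [J]. *)
Lemma lowest_coef (A L : comNzRingType) (h : {rmorphism A -> L}) (I J : set L) x
    (f : {poly A}) :
  is_ideal I -> is_ideal J -> I `<=` J -> J x -> (forall y, I (x * y) -> I y) ->
  f != 0 -> I (poly_eval h x f) -> exists2 a, a != 0 & J (h a).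
Proof.
move=> hI hJ IJ Jx xreg; elim/poly_ind: f => [|p c IHp]; first by rewrite eqxx.
rewrite rmorphD rmorphM /= poly_evalC poly_evalX => f0 If.
have [c0|c0] := eqVneq c 0; last first.
  exists c => //; rewrite -[h c](addKr (poly_eval h x p * x)) addrC.
  apply: idealB => //; first exact: IJ.
  exact: idealMl.
rewrite c0 rmorph0 addr0 mulrC in If.
apply: IHp; last exact: xreg.
by apply: contraNneq f0 => ->; rewrite c0 mul0r addr0.
Qed.

(** The nesting of univariate polynomials lets [lowest_coef] eliminate [x], then [y], then [z]. *)
Definition alg_dep3 (k : fieldType) (L : comNzRingType) (h : {rmorphism k -> L})
    (x y z : L) : Prop :=
  exists2 f : {poly {poly {poly k}}}, f != 0 &
    poly_eval (poly_eval (poly_eval h z) y) x f = 0.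

(** Common form of a chain of primes and of a regular sequence of length 3. Three uses of
    [lowest_coef] leave a nonzero constant of k in the last ideal. *)
Lemma nested_ideals3 (k : fieldType) (L : comNzRingType) (h : {rmorphism k -> L})
    (I : nat -> set L) (x : nat -> L) :
  (forall i, (i <= 3)%N -> is_ideal (I i)) ->
  (forall i, (i < 3)%N -> [/\ I i `<=` I i.+1, I i.+1 (x i) &
     forall y, I i (x i * y) -> I i y]) ->
  alg_dep3 h (x 0%N) (x 1%N) (x 2%N) -> I 3%N 1.
Proof.
move=> hI hx [f f0 fE].
have [I01 Ix0 reg0] := hx 0%N isT; have [I12 Ix1 reg1] := hx 1%N isT.
have [I23 Ix2 reg2] := hx 2%N isT.
have If : I 0%N (poly_eval (poly_eval (poly_eval h (x 2%N)) (x 1%N)) (x 0%N) f).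
  by rewrite fE; apply: ideal0; apply: hI.
have [f1 f10 If1] := lowest_coef (hI 0%N isT) (hI 1%N isT) I01 Ix0 reg0 f0 If.
have [f2 f20 If2] := lowest_coef (hI 1%N isT) (hI 2%N isT) I12 Ix1 reg1 f10 If1.
have [c c0 Ic] := lowest_coef (hI 2%N isT) (hI 3%N isT) I23 Ix2 reg2 f20 If2.
rewrite -(rmorph1 h) -(mulVf c0) rmorphM; apply: idealMl => //; exact: hI.
Qed.

(** An ideal maximal among those that contain F and no power of G is prime. *)
Lemma prime_avoiding (L : comNzRingType) (F G : L) :
  (forall n c, G ^+ n <> c * F) -> exists p, [/\ is_prime p, p F & ~ p G].
Proof.
move=> GF; pose Q (J : set L) := [/\ is_ideal J, J F & forall n, ~ J (G ^+ n)].
have [|J [Jgood Jmax]] := @Zorn_bigcup L (fun J => J = set0 \/ Q J).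
  move=> Fam FamQ tot.
  have [[J0 [FJ0 QJ0]]|noQ] := pselect (exists J, Fam J /\ Q J); last first.
    left; apply/seteqP; split=> // x [J FJ Jx].
    have [J0|QJ] := FamQ J FJ; first by rewrite J0 in Jx.
    by case: noQ; exists J.
  have goodQ J x : Fam J -> J x -> Q J.
    by move=> FJ Jx; case: (FamQ J FJ) => // J0'; rewrite J0' in Jx.
  right; split; [split|exists J0 => //; by case: QJ0|].
  + by exists J0 => //; case: QJ0 => hJ _ _; apply: ideal0.
  + move=> x y [J1 FJ1 J1x] [J2 FJ2 J2y].
    have [h1 _ _] := goodQ _ _ FJ1 J1x; have [h2 _ _] := goodQ _ _ FJ2 J2y.
    by have [s12|s21] := tot _ _ FJ1 FJ2; [exists J2 => //|exists J1 => //];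
      apply: idealD => //; [apply: s12|apply: s21].
  + move=> c x [J FJ Jx]; exists J => //; have [hJ _ _] := goodQ _ _ FJ Jx.
    exact: idealMl.
  + move=> n [J FJ Jx]; have [_ _ nJ] := goodQ _ _ FJ Jx; exact: nJ Jx.
pose J0 : set L := [set z | exists c, z = c * F].
have QJ0 : Q J0.
  split; [split|by exists 1; rewrite mul1r|by move=> n [c /GF]].
  + by exists 0; rewrite mul0r.
  + by move=> _ _ [c ->] [c' ->]; exists (c + c'); rewrite mulrDl.
  + by move=> b _ [c ->]; exists (b * c); rewrite mulrA.
have [hJ JF nJ] : Q J.
  case: Jgood => // J_0; exfalso; apply: (Jmax J0); last by right.
  rewrite J_0; split; first by move=> x [].
  by move=> /(_ F) sub; apply: sub; exists 1; rewrite mul1r.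
have adj x : ~ J x -> exists n j c, J j /\ G ^+ n = j + c * x.
  move=> nJx; have [//|nE] := pselect (exists n j c, J j /\ G ^+ n = j + c * x).
  pose J1 : set L := [set z | exists j c, J j /\ z = j + c * x].
  have QJ1 : Q J1.
    split; [split| |].
    + by exists 0, 0; rewrite mul0r addr0; split=> //; apply: ideal0.
    + move=> _ _ [p [c [Pp ->]]] [p' [c' [Pp' ->]]]; exists (p + p'), (c + c').
      by split; [apply: idealD | rewrite mulrDl addrACA].
    + move=> b _ [p [c [Pp ->]]]; exists (b * p), (b * c).
      by split; [apply: idealMl | rewrite mulrDr mulrA].
    + by exists F, 0; rewrite mul0r addr0.
    + by move=> n [j [c hjc]]; apply: nE; exists n, j, c.
  exfalso; apply: (Jmax J1); last by right.
  split; first by move=> j Jj; exists j, 0; rewrite mul0r addr0.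
  move=> /(_ x) sub; apply: nJx; apply: sub; exists 0, 1.
  by rewrite mul1r add0r; split=> //; apply: ideal0.
exists J; split=> //; last by rewrite -[G]expr1; apply: nJ.
split=> // [|x y Jxy]; first by rewrite -(expr0 G); apply: nJ.
have [|/adj[n [j [c [Jj E]]]]] := pselect (J x); first by left.
have [|/adj[n' [j' [c' [Jj' E']]]]] := pselect (J y); first by right.
exfalso; apply: (nJ (n + n')%N); rewrite exprD E E'.
have -> : (j + c * x) * (j' + c' * y) =
  (j' + c' * y) * j + c * x * j' + c * c' * (x * y) by ring.
by apply: idealD => //; [apply: idealD => //|]; apply: idealMl.
Qed.

End NestedIdeals.

(** * A criterion for local rings of dimension 2 *)

Section LocalCohenMacaulay.
Local Open Scope classical_set_scope.
Local Open Scope ring_scope.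

Variables (k : fieldType) (L : comNzRingType) (h : {rmorphism k -> L}).
Variables (M : set L) (F G : L).
Hypothesis M_max : is_maximal M.
Hypothesis M_uniq : forall J, is_maximal J -> J = M.
Hypothesis M_proper : forall J : set L, is_ideal J -> ~ J 1 -> J `<=` M.
Hypothesis L_dom : forall x y : L, x * y = 0 -> x = 0 \/ y = 0.
Hypothesis L_dep : forall x y z : L, alg_dep3 h x y z.
Hypotheses (MF : M F) (MG : M G) (F_neq0 : F <> 0).
Hypothesis FG_reg : forall t c, G * t = c * F -> exists c', t = c' * F.

Let M_ideal : is_ideal M. Proof. by case: M_max. Qed.
Let M1 : ~ M 1. Proof. by case: M_max. Qed.

(** The chain is 0, p, M with p containing F but not G; such a p exists because [FG_reg] would turn
    G^n in (F) into 1 in (F). For the upper bound, elements of C_(i+1) outside C_i are fed to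
    [nested_ideals3]. *)
Lemma krull_dim2 : krull_dim L 2.
Proof.
split.
  have [|p [pp pF pG]] := @prime_avoiding L F G.
    move=> n c; elim: n c => [|n IHn] c.
      by rewrite expr0 => E; apply: M1; rewrite E; apply: idealMl.
    by rewrite exprS => /FG_reg[c' /IHn].
  have [hp p1 _] := pp.
  pose C n : set L := if n is 0%N then [set 0] else if n is 1%N then p else M.
  exists C; split=> [[|[|[|//]]] _ /=|[|[|//]] _ /=].
  - split=> [|/eqP|x y /L_dom //]; last by rewrite oner_eq0.
    by split=> // [_ _ -> ->|c _ ->]; rewrite ?addr0 ?mulr0.
  - exact: pp.
  - exact: maximal_prime.
  - split=> [x ->|/(_ F pF)/F_neq0//]; exact: ideal0.
  - split=> [|/(_ G MG)//]; exact: M_proper.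
move=> m C [Cp Cs]; rewrite leqNgt; apply/negP => m3.
have /choice[x xP] : forall i, exists x, (i < 3)%N -> C i.+1 x /\ ~ C i x.
  move=> i; have [i3|_] := ltnP i 3; last by exists 0.
  have [_ nsub] := Cs i (leq_trans i3 m3).
  have [[x hx]|nE] := pselect (exists x, C i.+1 x /\ ~ C i x); first by exists x.
  case: nsub => x Cx; have [//|nCx] := pselect (C i x).
  by case: nE; exists x.
have [_ C1 _] := Cp 3 m3; apply: C1.
apply: (nested_ideals3 (h := h) (x := x)) => [i i3|i i3|]; last exact: L_dep.
  by have [] := Cp i (leq_trans i3 m3).
have [Cx nCx] := xP i i3; split=> //.
  by have [] := Cs i (leq_trans i3 m3).
have [_ _ Ci_prime] := Cp i (ltnW (leq_trans i3 m3)).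
by move=> y /Ci_prime[].
Qed.

(** F, G is a regular sequence by [FG_reg]. In a longer one, the ideals of the initial segments
    satisfy [nested_ideals3], so three terms would already generate 1. *)
Lemma depth2 : depth M 2.
Proof.
split.
  exists [:: F; G]; split=> //; last by move=> x; rewrite !inE => /orP[]/eqP->.
  split=> [[|[|//]] _ x /=|].
  - move=> /ideal_span_nil/L_dom[//|->]; exact: (ideal0 (ideal_span_ideal _)).
  - by move=> /ideal_span_seq1[c /FG_reg]/ideal_span_seq1.
  apply: contra_not M1; apply: ideal_span_sub => // x /=.
  by rewrite !inE => /orP[]/eqP->.
move=> s [sreg s1] sM; rewrite leqNgt; apply/negP => s3.
apply: s1; have sub3 : [set y | y \in take 3 s] `<=` [set y | y \in s].
  by move=> y /=; apply: mem_take.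
apply: (ideal_span_sub (ideal_span_ideal _)
  (fun y hy => mem_ideal_span (sub3 y hy))).
apply: (nested_ideals3 (h := h) (I := fun i => ideal_span [set y | y \in take i s])
  (x := fun i => s`_i)) => [i _|i i3|]; last exact: L_dep.
  exact: ideal_span_ideal.
have i_s : (i < size s)%N by apply: leq_trans i3 s3.
split; last by move=> y; apply: sreg.
  apply: ideal_span_sub => [|y /= ys]; first exact: ideal_span_ideal.
  by apply: mem_ideal_span; rewrite /= (take_nth 0) // mem_rcons inE ys orbT.
by apply: mem_ideal_span; rewrite /= (take_nth 0) // mem_rcons mem_head.
Qed.

Theorem cohen_macaulay_local2 : cohen_macaulay_local L.
Proof. by exists M, 2; split=> //; [exact: krull_dim2 | exact: depth2]. Qed.

End LocalCohenMacaulay.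

(** * Localization inside a field *)

Section Localization.
Local Open Scope classical_set_scope.
Local Open Scope ring_scope.

Lemma poly_eval_comp (A B C : comNzRingType) (h : {rmorphism A -> B})
    (h' : {rmorphism A -> C}) (u : {rmorphism B -> C}) x p :
  (forall y, u (h y) = h' y) -> u (poly_eval h x p) = poly_eval h' (u x) p.
Proof.
move=> uh; elim/poly_ind: p => [|p c IHp]; first by rewrite !rmorph0.
by rewrite !rmorphD !rmorphM /= IHp !poly_evalC !poly_evalX uh.
Qed.

Variables (A : comNzRingType) (F : fieldType) (f : {rmorphism A -> F}).
Hypothesis f_inj : injective f.
Variables (P : set A) (P_prime : is_prime P).

(** The localization is realized as a subring of the field F; the proof of primality is an argument
    because the subring structure depends on it. *)
Definition loc_pred of is_prime P : {pred F} :=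
  fun z => `[< exists x s, ~ P s /\ z = f x / f s >].

Let P_ideal : is_ideal P. Proof. by case: P_prime. Qed.
Let P1 : ~ P 1. Proof. by case: P_prime. Qed.

Let f_neq0 s : ~ P s -> f s != 0.
Proof.
move=> Ps; apply/eqP => fs0; apply: Ps.
have -> : s = 0 by apply: f_inj; rewrite rmorph0.
exact: ideal0.
Qed.

Let P_mul s s' : ~ P s -> ~ P s' -> ~ P (s * s').
Proof. by case: P_prime => _ _ hP Ps Ps' /hP[]. Qed.

Lemma loc_predP x s : ~ P s -> f x / f s \in loc_pred P_prime.
Proof. by move=> Ps; apply/asboolP; exists x, s. Qed.

Lemma loc_pred_closed : subring_closed (loc_pred P_prime).
Proof.
split.
- have := loc_predP 1 P1; by rewrite rmorph1 divr1.
- move=> _ _ /asboolP[x [s [Ps ->]]] /asboolP[y [t [Pt ->]]].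
  have -> : f x / f s - f y / f t = f (x * t - y * s) / f (s * t).
    by rewrite rmorphB !rmorphM; field; rewrite !f_neq0.
  exact/loc_predP/P_mul.
- move=> _ _ /asboolP[x [s [Ps ->]]] /asboolP[y [t [Pt ->]]].
  have -> : f x / f s * (f y / f t) = f (x * y) / f (s * t).
    by rewrite !rmorphM; field; rewrite !f_neq0.
  exact/loc_predP/P_mul.
Qed.

HB.instance Definition _ :=
  GRing.isSubringClosed.Build F (loc_pred P_prime) loc_pred_closed.

Record loc := Loc { loc_val : F; loc_valP : loc_val \in loc_pred P_prime }.

HB.instance Definition _ := [isSub for loc_val].
HB.instance Definition _ := [Choice of loc by <:].
HB.instance Definition _ := [SubChoice_isSubComNzRing of loc by <:].

Lemma loc_map_subproof x : f x \in loc_pred P_prime.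
Proof. by have := loc_predP x P1; rewrite rmorph1 divr1. Qed.

Definition loc_map x : loc := Loc (loc_map_subproof x).

Lemma loc_map_additive : {morph loc_map : x y / x - y}.
Proof. by move=> x y; apply: val_inj; rewrite /= rmorphB. Qed.

Lemma loc_map_multiplicative : monoid_morphism loc_map.
Proof.
by split=> [|x y]; apply: val_inj; rewrite /= ?rmorph1 ?rmorphM.
Qed.

HB.instance Definition _ :=
  GRing.isZmodMorphism.Build A loc loc_map loc_map_additive.
HB.instance Definition _ :=
  GRing.isMonoidMorphism.Build A loc loc_map loc_map_multiplicative.

Let L : comNzRingType := loc.
Let g : {rmorphism A -> L} := loc_map.
Let v : {rmorphism L -> F} := (val : loc -> F).

Let v_inj : injective v. Proof. exact: val_inj. Qed.
Let vg x : v (g x) = f x. Proof. by []. Qed.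

Let locP (z : L) : exists x s, ~ P s /\ v z = f x / f s.
Proof. by apply/asboolP; apply: loc_valP. Qed.

Let frac x s : ~ P s -> exists z : L, v z = f x / f s.
Proof. by move=> Ps; exists (Loc (loc_predP x Ps)). Qed.

Lemma loc_mapP : localization_at P g.
Proof.
split.
- move=> s Ps; have [u uE] := frac 1 Ps; exists u; apply: v_inj.
  by rewrite rmorphM vg uE !rmorph1 mul1r divff ?f_neq0.
- move=> z; have [x [s [Ps zE]]] := locP z; exists x, s; split=> //.
  by apply: v_inj; rewrite rmorphM !vg zE divfK ?f_neq0.
- move=> x /(congr1 v); rewrite vg rmorph0 => fx0; exists 1; split=> //.
  by rewrite mul1r; apply: f_inj; rewrite rmorph0.
Qed.

Let M : set L := [set z | exists x s, [/\ P x, ~ P s & v z = f x / f s]].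

Let M_ideal : is_ideal M.
Proof.
split.
- exists 0, 1; split=> //; first exact: ideal0.
  by rewrite !rmorph0 mul0r.
- move=> z z' [x [s [Px Ps zE]]] [x' [s' [Px' Ps' zE']]].
  exists (x * s' + x' * s), (s * s'); split; last 1 first.
  + by rewrite rmorphD zE zE' rmorphD !rmorphM; field; rewrite !f_neq0.
  + by apply: idealD => //; apply: idealMr.
  + exact: P_mul.
- move=> z z' [x [s [Px Ps zE]]]; have [x' [s' [Ps' zE']]] := locP z.
  exists (x' * x), (s' * s); split; last 1 first.
  + by rewrite rmorphM zE zE' !rmorphM; field; rewrite !f_neq0.
  + exact: idealMl.
  + exact: P_mul.
Qed.

Let M1 : ~ M 1.
Proof.
move=> [x [s [Px Ps]]]; rewrite rmorph1 => /esym/divr1_eq/f_inj xs.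
by rewrite xs in Px.
Qed.

Let M_proper (J : set L) : is_ideal J -> ~ J 1 -> J `<=` M.
Proof.
move=> hJ J1 z Jz; have [x [s [Ps zE]]] := locP z.
have [Px|Px] := pselect (P x); first by exists x, s.
have [u uE] := frac s Px; case: J1.
have -> : 1 = u * z.
  by apply: v_inj; rewrite rmorphM rmorph1 uE zE; field; rewrite !f_neq0.
exact: idealMl.
Qed.

Let M_max : is_maximal M.
Proof.
split=> // J hJ J1 MJ; apply/seteqP; split=> //; exact: M_proper.
Qed.

Let M_uniq (J : set L) : is_maximal J -> J = M.
Proof.
by move=> [hJ J1 Jmax]; apply/esym/Jmax => //; apply: M_proper.
Qed.

(** By clearing denominators, the conditions of the local criterion reduce to conditions on [x] and
    [y] in A and on fractions in F. *)
Lemma loc_cohen_macaulay (k : fieldType) (i : {rmorphism k -> A}) (x y : A) :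
  (forall x0 s0 x1 s1 x2 s2, f s0 != 0 -> f s1 != 0 -> f s2 != 0 ->
     alg_dep3 (f \o i) (f x0 / f s0) (f x1 / f s1) (f x2 / f s2)) ->
  P x -> P y -> x <> 0 ->
  (forall t c, y * t = c * x -> exists c', t = c' * x) ->
  cohen_macaulay_local L.
Proof.
move=> dep Px Py x0 xy_reg.
have Pg t : P t -> M (g t) by move=> Pt; exists t, 1; rewrite vg rmorph1 divr1.
apply: (@cohen_macaulay_local2 k L (g \o i) M (g x) (g y)) => //.
- move=> u w uw0; have /eqP : v (u * w) = 0 by rewrite uw0 rmorph0.
  rewrite rmorphM mulf_eq0 => /orP[]/eqP E; [left|right];
    by apply: v_inj; rewrite E rmorph0.
- move=> u0 u1 u2; have [x0' [s0 [/f_neq0 Ps0 u0E]]] := locP u0.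
  have [x1 [s1 [/f_neq0 Ps1 u1E]]] := locP u1.
  have [x2 [s2 [/f_neq0 Ps2 u2E]]] := locP u2.
  have := dep x0' s0 x1 s1 x2 s2 Ps0 Ps1 Ps2; rewrite -u0E -u1E -u2E => -[q q0 qE].
  exists q => //; apply: v_inj; rewrite rmorph0 -[RHS]qE.
  by do 3![apply: poly_eval_comp => ?].
- exact: Pg.
- exact: Pg.
- by move=> /(congr1 v); rewrite vg rmorph0 -(rmorph0 f) => /f_inj.
move=> t c; have [x1 [s1 [Ps1 tE]]] := locP t; have [x2 [s2 [Ps2 cE]]] := locP c.
move=> /(congr1 v); rewrite !rmorphM !vg tE cE => E.
have /xy_reg[b bE] : y * (x1 * s2) = x2 * s1 * x.
  apply: f_inj; rewrite !rmorphM.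
  have -> : f y * (f x1 * f s2) = f y * (f x1 / f s1) * (f s1 * f s2).
    by field; rewrite f_neq0.
  by rewrite E; field; rewrite f_neq0.
have [b' b'E] := frac b (P_mul Ps1 Ps2); exists b'.
apply: v_inj; rewrite tE rmorphM vg b'E.
have -> : f x1 / f s1 = f (x1 * s2) / (f s1 * f s2).
  by rewrite rmorphM; field; rewrite !f_neq0.
by rewrite bE !rmorphM; field; rewrite !f_neq0.
Qed.

End Localization.

(** * Algebraic dependence of three fractions *)

Section AlgebraicDependence.
Local Open Scope ring_scope.

Lemma linear_dependence (k : fieldType) (I J : finType) (F : I -> J -> k) :
  (#|J| < #|I|)%N ->
  exists2 c : I -> k, exists i, c i != 0 & forall j, \sum_i c i * F i j = 0.
Proof.
move=> ltJI; pose A := \matrix_(i < #|I|, j < #|J|) F (enum_val i) (enum_val j).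
have : kermx A != 0.
  rewrite -mxrank_eq0 mxrank_ker -lt0n subn_gt0.
  exact: leq_ltn_trans (rank_leq_col _) ltJI.
rewrite -nz_row_eq0 => nz; exists (fun i => nz_row (kermx A) 0 (enum_rank i)).
  have /rV0Pn[i hi] := nz; exists (enum_val i); by rewrite enum_valK.
move=> j; have /sub_kermxP/rowP/(_ (enum_rank j)) := nz_row_sub (kermx A).
rewrite !mxE => E; rewrite -[RHS]E (reindex_onto enum_val enum_rank) /=; last first.
  by move=> i _; rewrite enum_rankK.
by apply: eq_big => [i|i _]; rewrite ?enum_valK ?eqxx // mxE enum_rankK.
Qed.

Lemma monomial_clear_denom (F : fieldType) (b u0 u1 u2 s : F) i j l n :
  s != 0 -> (i + j + l <= n)%N ->
  s ^+ n * (b * (u2 / s) ^+ l * (u1 / s) ^+ j * (u0 / s) ^+ i) =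
  b * (u0 ^+ i * u1 ^+ j * u2 ^+ l * s ^+ (n - (i + j + l))).
Proof.
move=> s0 le_n; rewrite -{1}(subnKC le_n); set e := (n - _)%N.
rewrite !exprMn !exprVn !exprD.
have := (expf_neq0 i s0, expf_neq0 j s0, expf_neq0 l s0).
move: (s ^+ i) (s ^+ j) (s ^+ l) (s ^+ e) (u0 ^+ i) (u1 ^+ j) (u2 ^+ l).
by move=> si sj sl se v0 v1 v2 [[h1 h2] h3]; field; rewrite h1 h2 h3.
Qed.

Lemma triple_coef (A : nzRingType) (c : A) i j l i' j' l' :
  ((((c *: 'X^l)%:P * 'X^j)%:P * 'X^i)`_i')`_j'`_l' =
  c * [&& i == i', j == j' & l == l']%:R.
Proof.
rewrite coefCM coefXn eq_sym; case: eqP => _ /=; last by rewrite !mulr0 !coef0.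
rewrite mulr1 coefCM coefXn eq_sym; case: eqP => _ /=; last by rewrite !mulr0 !coef0.
by rewrite mulr1 coefZ coefXn eq_sym.
Qed.

Variable k : fieldType.
Local Notation K := {mpoly k[2]}.

Definition deg_le (n : nat) (p : K) := forall m, m \in msupp p -> (mdeg m <= n)%N.

Lemma deg_leM n n' p q : deg_le n p -> deg_le n' q -> deg_le (n + n') (p * q).
Proof.
move=> hp hq m /msuppM_le/allpairsP[[m1 m2] /= [/hp h1 /hq h2 ->]].
by rewrite mdegD leq_add.
Qed.

Lemma deg_leX n p e : deg_le n p -> deg_le (e * n) (p ^+ e).
Proof.
move=> hp; elim: e => [|e IHe]; last by rewrite exprS mulSn; apply: deg_leM.
by move=> m; rewrite expr0 msupp1 inE => /eqP->; rewrite mdeg0.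
Qed.

Lemma deg_leW n n' p : (n <= n')%N -> deg_le n p -> deg_le n' p.
Proof. by move=> le_n hp m /hp/leq_trans; apply. Qed.

Lemma deg_le_msize p : deg_le (msize p) p.
Proof. by move=> m /msize_mdeg_lt/ltnW. Qed.

(** The monomials in the three fractions with exponents below n, multiplied by s^(3n), are
    polynomials in two variables of degree at most 3 n D; for large n there are too many of them to
    be independent. *)
Lemma common_denom_alg_dep3 (F : fieldType) (f : {rmorphism K -> F}) (x0 x1 x2 s : K) :
  f s != 0 ->
  alg_dep3 (f \o @mpolyC 2 k) (f x0 / f s) (f x1 / f s) (f x2 / f s).
Proof.
move=> s0.
pose D := maxn (maxn (msize x0) (msize x1)) (maxn (msize x2) (msize s)).
have [h0 h1 h2 hs] : [/\ deg_le D x0, deg_le D x1, deg_le D x2 & deg_le D s].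
  by split; apply: (fun p h => deg_leW h (@deg_le_msize p)); rewrite /D; lia.
(* The n^3 products have coefficient vectors of length M^2. As M <= n (3 D + 1), the choice n > (3 D
   + 1)^2 gives M^2 < n^3. *)
pose n := ((3 * D).+1 * (3 * D).+1).+1; pose M := (3 * n * D).+1.
pose I := ('I_n * 'I_n * 'I_n)%type; pose J := ('I_M * 'I_M)%type.
pose T (i : I) : K :=
  x0 ^+ i.1.1 * x1 ^+ i.1.2 * x2 ^+ i.2 * s ^+ (3 * n - (i.1.1 + i.1.2 + i.2)).
have T_le i : deg_le (3 * n * D) (T i).
  have [l0 [l1 l2]] := (ltn_ord i.1.1, (ltn_ord i.1.2, ltn_ord i.2)).
  have -> : (3 * n * D = i.1.1 * D + i.1.2 * D + i.2 * D +
      (3 * n - (i.1.1 + i.1.2 + i.2)) * D)%N.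
    have le3 (u0 u1 u2 n' : nat) :
        (u0 < n' -> u1 < n' -> u2 < n' -> u0 + u1 + u2 <= 3 * n')%N by lia.
    by rewrite -!mulnDl subnKC // le3.
  by do 3![apply: deg_leM; last exact: deg_leX]; apply: deg_leX.
have [|c [i0 ci0] cE] := @linear_dependence k I J (fun i j => (T i)@_(mon j.1 j.2)).
  rewrite !card_prod !card_ord.
  have le_M : (M <= n * (3 * D).+1)%N.
    by rewrite /M mulnS [(3 * n)%N]mulnC -mulnA -add1n leq_add2r.
  apply: leq_ltn_trans (leq_mul le_M le_M) _.
  by rewrite mulnACA ltn_pmul2l // /n.
have sum0 : \sum_i c i *: T i = 0.
  apply/mpolyP => m; rewrite mcoeff0 raddf_sum /=.
  have [lt_m|le_m] := ltnP (mdeg m) M; last first.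
    apply: big1 => i _; rewrite mcoeffZ memN_msupp_eq0 ?mulr0 //.
    by apply/negP => /T_le; rewrite leqNgt le_m.
  have lt0 : (m ord0 < M)%N.
    by apply: leq_ltn_trans lt_m; rewrite [m]monE mdeg_mon mon0 leq_addr.
  have lt1 : (m ord_max < M)%N.
    by apply: leq_ltn_trans lt_m; rewrite [m]monE mdeg_mon mon1 leq_addl.
  rewrite -[RHS](cE (Ordinal lt0, Ordinal lt1)) /= -monE.
  by apply: eq_bigr => i _; rewrite mcoeffZ.
pose q : {poly {poly {poly k}}} :=
  \sum_(i : I) ((c i *: 'X^(i.2))%:P * 'X^(i.1.2))%:P * 'X^(i.1.1).
exists q.
  apply: contraNneq ci0 => q0.
  have := congr1 (fun p : {poly {poly {poly k}}} => p`_i0.1.1`_i0.1.2`_i0.2) q0.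
  rewrite !coef0 /q !coef_sum (bigD1 i0) //= big1 => [|i ni].
    by rewrite addr0 triple_coef !eqxx mulr1 => ->.
  rewrite triple_coef; case: eqP => [E1|_] /=; last by rewrite mulr0.
  case: eqP => [E2|_] /=; last by rewrite mulr0.
  case: eqP => [E3|_] /=; last by rewrite mulr0.
  case/eqP: ni; move: E1 E2 E3; case: i => [[i j] l]; case: (i0) => [[i' j'] l'] /=.
  by move=> /val_inj-> /val_inj-> /val_inj->.
rewrite rmorph_sum /=.
apply: (mulfI (expf_neq0 (3 * n) s0)); rewrite mulr0 mulr_sumr.
rewrite -[RHS](rmorph0 f) -sum0 rmorph_sum; apply: eq_bigr => i _.
have le3 : (i.1.1 + i.1.2 + i.2 <= 3 * n)%N.
  by have [l0 [l1 l2]] := (ltn_ord i.1.1, (ltn_ord i.1.2, ltn_ord i.2)); lia.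
rewrite /T -mul_mpolyC !(rmorphM, rmorphXn, poly_evalC, poly_evalX) /=.
rewrite -mul_polyC !(rmorphM, rmorphXn, poly_evalC, poly_evalX) /=.
exact: monomial_clear_denom.
Qed.

Lemma fraction_alg_dep3 (F : fieldType) (f : {rmorphism K -> F})
    (x0 s0 x1 s1 x2 s2 : K) : f s0 != 0 -> f s1 != 0 -> f s2 != 0 ->
  alg_dep3 (f \o @mpolyC 2 k) (f x0 / f s0) (f x1 / f s1) (f x2 / f s2).
Proof.
move=> h0 h1 h2.
have -> : f x0 / f s0 = f (x0 * s1 * s2) / f (s0 * s1 * s2).
  by rewrite !rmorphM; field; rewrite h0 h1 h2.
have -> : f x1 / f s1 = f (x1 * s0 * s2) / f (s0 * s1 * s2).
  by rewrite !rmorphM; field; rewrite h0 h1 h2.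
have -> : f x2 / f s2 = f (x2 * s0 * s1) / f (s0 * s1 * s2).
  by rewrite !rmorphM; field; rewrite h0 h1 h2.
by apply: common_denom_alg_dep3; rewrite !rmorphM !mulf_neq0.
Qed.

End AlgebraicDependence.

(** * Polynomial relations modulo a maximal ideal *)

Section ZeroDimensional.
Local Open Scope classical_set_scope.
Local Open Scope ring_scope.

(** Modulo [f] the matrix is the scalar matrix [b], and congruences pass through the sums and
    products of the determinant. *)
Lemma det_congr (C : comNzRingType) n (b f : C) (T : 'M[C]_n) :
  exists q, \det (b%:M - f *: T) = b ^+ n + q * f.
Proof.
pose Rel x y := exists q, x = y + q * f :> C.
have Rel0 x : Rel x x by exists 0; rewrite mul0r addr0.
have RelD x y x' y' : Rel x y -> Rel x' y' -> Rel (x + x') (y + y').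
  by move=> [q ->] [q' ->]; exists (q + q'); ring.
have RelM x y x' y' : Rel x y -> Rel x' y' -> Rel (x * x') (y * y').
  by move=> [q ->] [q' ->]; exists (q * y' + q' * y + q * q' * f); ring.
rewrite -det_scalar; apply: (big_ind2 Rel (Rel0 0) _) => [x1 x2 y1 y2|s _].
  exact: RelD.
apply: (RelM) => //; apply: (big_ind2 Rel (Rel0 1) _) => [x1 x2 y1 y2|i _].
  exact: RelM.
rewrite !mxE.
by exists (- T i (s i)); rewrite mulNr mulrC.
Qed.

Section DeterminantTrick.
Variables (C R : comNzRingType) (h : {rmorphism C -> R}) (P : set R).
Hypothesis P_max : is_maximal P.
Variables (n : nat) (e : 'I_n -> R) (l f : C).
Hypothesis span : forall r, exists N (b : 'I_n -> C),
  P (h l ^+ N * r - \sum_i h (b i) * e i).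
Hypotheses (Pl : ~ P (h l)) (Pf : ~ P (h f)).

(* An inverse [u] of [f] in the field [R / P] acts on the generators [e] through a
   matrix with denominators [l ^ N]. Clearing denominators in [1 - f u = 0] gives a
   matrix [l ^ N - f T] that kills the generators, so [P] contains its determinant. *)
Lemma determinant_trick : exists N q m, P (h (l ^+ N ^+ m + q * f)).
Proof.
have P_prime := maximal_prime P_max; have [hP P1 Pprime] := P_prime.
have [u fu] := maximal_unit P_max Pf.
have /choice[Nb NbP] : forall i, exists Nb : nat * ('I_n -> C),
    P (h l ^+ Nb.1 * (u * e i) - \sum_j h (Nb.2 j) * e j).
  by move=> i; have [N [b hb]] := span (u * e i); exists (N, b).
pose N := (\sum_i (Nb i).1)%N.
have N_ge i : ((Nb i).1 <= N)%N by rewrite /N (bigD1 i) //= leq_addr.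
pose T : 'M[C]_n := \matrix_(i, j) (l ^+ (N - (Nb i).1) * (Nb i).2 j).
pose X := (l ^+ N)%:M - f *: T.
have PX i : P (\sum_j h (X i j) * e j).
  have -> : \sum_j h (X i j) * e j = h f * h l ^+ (N - (Nb i).1) *
      (h l ^+ (Nb i).1 * (u * e i) - \sum_j h ((Nb i).2 j) * e j)
      - (h f * u - 1) * (h l ^+ N * e i).
    have -> : \sum_j h (X i j) * e j = h l ^+ N * e i -
        h f * h l ^+ (N - (Nb i).1) * \sum_j h ((Nb i).2 j) * e j.
      rewrite mulr_sumr.
      have -> : h l ^+ N * e i = \sum_j h (((l ^+ N)%:M : 'M_n) i j) * e j.
        rewrite (bigD1 i) //= big1 ?addr0 => [|j ji].
          by rewrite mxE eqxx rmorphXn.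
        by rewrite mxE eq_sym (negPf ji) rmorph0 mul0r.
      rewrite -sumrB; apply: eq_bigr => j _.
      rewrite /X [in LHS]mxE [X in _ + X]mxE [(f *: T) i j]mxE rmorphB mulrBl.
      congr (_ - _); rewrite [T i j]mxE !rmorphM rmorphXn; ring.
    rewrite -(subnK (N_ge i)) exprD; move: (_ - _)%N => t; move: (\sum_j _) => Y.
    by rewrite addnK; ring.
  apply: idealB => //; first exact: idealMl.
  exact: idealMr.
have Pdet j : P (h (\det X) * e j).
  have -> : h (\det X) * e j = \sum_i h (\adj X j i) * \sum_m h (X i m) * e m.
    under eq_bigr => i _ do rewrite mulr_sumr.
    rewrite exchange_big /= (bigD1 j) //= [X in _ + X]big1 ?addr0 => [|m mj].
      under eq_bigr => i _ do rewrite mulrA -rmorphM.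
      rewrite -mulr_suml -rmorph_sum; congr (h _ * _).
      by have /matrixP/(_ j j) := mul_adj_mx X; rewrite !mxE eqxx mulr1n => <-.
    under eq_bigr => i _ do rewrite mulrA -rmorphM.
    rewrite -mulr_suml -rmorph_sum.
    have /matrixP/(_ j m) := mul_adj_mx X; rewrite !mxE eq_sym (negPf mj) mulr0n => ->.
    by rewrite rmorph0 mul0r.
  by apply: ideal_sum => // i _; apply: idealMl.
have [q qE] := det_congr (l ^+ N) f T; exists N, q, n; rewrite -qE -/X.
(* If P misses the determinant, it contains every [e j], hence by [span] a power of [h l], against
   [Pl]. *)
have [//|nPdet] := pselect (P (h (\det X))).
have Pe j : P (e j) by have [] := Pprime _ _ (Pdet j).
have [N1 [b Pb]] := span 1; exfalso.
have : P (h l ^+ N1).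
  rewrite -[_ ^+ _]mulr1 -(subrK (\sum_i h (b i) * e i) (_ * 1)).
  by apply: idealD => //; apply: ideal_sum => // i _; apply: idealMl.
by elim: N1 {Pb} => [|N1 IH]; rewrite ?expr0 // exprS => /Pprime[].
Qed.

End DeterminantTrick.

(** As in Euclid's proof that there are infinitely many primes, 1 + X l is nonconstant and coprime
    to l, so it cannot divide a power of l. *)
Lemma one_add_Xl_not_dvd (k : fieldType) (l : {poly k}) m (q : {poly k}) :
  l != 0 -> l ^+ m + q * (1 + 'X * l) != 0.
Proof.
move=> l0; apply/eqP => E; set f := 1 + 'X * l in E.
have cop : coprimep f l.
  apply/Bezout_coprimepP; exists (1, - 'X) => /=.
  by rewrite mul1r mulNr /f addrK eqpxx.
have : f %| l ^+ m * 1.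
  by rewrite mulr1 -(addrK (q * f) (l ^+ m)) E sub0r dvdpNr dvdp_mull.
rewrite Gauss_dvdpr ?coprimep_expr // dvdp1 /f addrC mulrC.
by rewrite size_MXaddC (negPf l0) /= eqSS size_poly_eq0 (negPf l0).
Qed.

Variables (k : fieldType) (R : comNzRingType) (i : {rmorphism k -> R}).
Variables (P : set R) (z w : R) (d : nat) (e : 'I_d -> R).
Hypothesis P_max : is_maximal P.
Local Notation ev1 := (poly_eval i z).
Local Notation ev2 := (poly_eval ev1 w).
Hypothesis span : forall r, exists b : 'I_d -> {poly {poly k}},
  r = \sum_v ev2 (b v) * e v.

(** The determinant trick over k[X][Y], without denominators and with f = X: the resulting element
    is 1 modulo X, hence nonzero. *)
Lemma maximal_bivariate_relation :
  ~ P z -> exists2 p : {poly {poly k}}, p != 0 & P (ev2 p).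
Proof.
move=> Pz; have [_ P1 _] := P_max.
have [||| N [q [m Pq]]] := @determinant_trick _ _ ev2 P P_max d e 1 'X%:P.
- move=> r; have [b ->] := span r; exists 0%N, b.
  by rewrite expr0 mul1r subrr; apply: ideal0; case: P_max.
- by rewrite rmorph1.
- by rewrite poly_evalC poly_evalX.
exists (1 ^+ N ^+ m + q * 'X%:P) => //.
rewrite !expr1n; apply/eqP => /(congr1 (fun p : {poly {poly k}} => p`_0`_0)).
rewrite coefD coefMC coefD coefMX eqxx addr0 !coef0 coef1 coef1 /=.
by move/eqP; rewrite oner_eq0.
Qed.

(** If P contained no nonzero f(z), the leading coefficient l(z) of a bivariate relation would be
    outside P, and division by that relation would make R / P finite over k[z] up to powers of l.
    The determinant trick for 1 + X l then puts a nonzero polynomial in z into P. *)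
Theorem maximal_univariate_relation : exists2 f : {poly k}, f != 0 & P (ev1 f).
Proof.
have [hP P1 _] := P_max.
have [Pz|Pz] := pselect (P z).
  by exists 'X; rewrite ?polyX_eq0 // poly_evalX.
have [p p0 Pp] := maximal_bivariate_relation Pz.
have [[f hf]|nE] := pselect (exists f : {poly k}, f != 0 /\ P (ev1 f)).
  by exists f; case: hf.
have noP (f : {poly k}) : f != 0 -> ~ P (ev1 f) by move=> f0 Pf; apply: nE; exists f.
exfalso; pose l := lead_coef p; have l0 : l != 0 by rewrite lead_coef_eq0.
pose J : finType := ('I_(size p) * 'I_d)%type.
pose e' (j : 'I_#|{: J}|) := w ^+ (enum_val j).1 * e (enum_val j).2.
have f0 : 1 + 'X * l != 0.
  rewrite addrC mulrC -size_poly_eq0 size_MXaddC (negPf l0) /=.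
  by [].
have [||| N [q [m Pq]]] := @determinant_trick _ _ ev1 P P_max _ e' l (1 + 'X * l).
- move=> r; have [b ->] := span r.
  (* [scalp] is the power of [l] needed in the pseudo-division of [b v] by [p]; [N] bounds all of
     these exponents. *)
  pose s v := scalp (b v) p; pose N := (\sum_v s v)%N.
  have s_le v : (s v <= N)%N by rewrite /N (bigD1 v) //= leq_addr.
  pose rem v := b v %% p.
  exists N, (fun j : 'I_#|{: J}| =>
    l ^+ (N - s (enum_val j).2) * (rem (enum_val j).2)`_(enum_val j).1).
  pose G (j : J) := ev1 (l ^+ (N - s j.2) * (rem j.2)`_j.1) * (w ^+ j.1 * e j.2).
  rewrite [X in _ - X](_ : _ = \sum_(j : J) G j); last first.
    rewrite [RHS](reindex (@enum_val J {: J})) //.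
    exact: (onW_bij _ (@enum_val_bij J)).
  rewrite -(pair_bigA _ (fun j v => G (j, v))) exchange_big /=.
  rewrite mulr_sumr -sumrB; apply: ideal_sum => // v _.
  have remE : \sum_(j < size p) G (j, v) = ev1 l ^+ (N - s v) * ev2 (rem v) * e v.
    have sz : (size (rem v) <= size p)%N by apply/ltnW; rewrite ltn_modp.
    have sz' : (size (map_poly ev1 (rem v)) <= size p)%N.
      exact: leq_trans (size_poly _ _) sz.
    rewrite [ev2 (rem v)]poly_evalE (horner_coef_wide _ sz').
    rewrite mulr_sumr mulr_suml; apply: eq_bigr => j _.
    by rewrite /G rmorphM rmorphXn (coef_map ev1) !mulrA.
  rewrite remE mulrA -mulrBl; apply: idealMr => //.
  have := congr1 ev2 (Pdiv.Idomain.divp_eq (b v) p).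
  rewrite -mul_polyC rmorphD !rmorphM /= poly_evalC rmorphXn -/l -/(s v) -/(rem v).
  move=> E; rewrite -{1}(subnK (s_le v)) exprD -mulrA E mulrDr addrK.
  by apply: idealMl => //; apply: idealMl.
- exact: noP.
- exact: noP.
by apply: noP Pq; rewrite -exprM; apply: one_add_Xl_not_dvd.
Qed.

End ZeroDimensional.

(** * Cohen-Macaulayness of R *)

Section CohenMacaulay.
Local Open Scope classical_set_scope.
Local Open Scope ring_scope.

(** The leading coefficient of [t] is a multiple of [f] because that of [g] is a unit; subtract the
    leading term and induct on the size of [t]. *)
Lemma dvd_of_unit_lead (C : idomainType) (f : C) (g t b : {poly C}) :
  lead_coef g \is a GRing.unit -> g * t = b * f%:P -> exists t', t = t' * f%:P.
Proof.
move=> ug; have [n] := ubnP (size t); elim: n t b => // n IHn t b st E.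
have [t0|t0] := eqVneq t 0; first by exists 0; rewrite t0 mul0r.
pose u := (lead_coef g)^-1 * b`_(size (g * t)%R).-1.
have uE : lead_coef t = u * f.
  have : lead_coef (g * t) = b`_(size (g * t)%R).-1 * f.
    by rewrite /lead_coef {1}E coefMC.
  by rewrite lead_coefM => h; rewrite /u -mulrA -h mulKr.
pose m := (size t).-1; have sz_t : size t = m.+1 by rewrite prednK ?size_poly_gt0.
pose t1 := t - (u * f) *: 'X^m.
have [||t' t'E] := IHn t1 (b - g * (u *: 'X^m)).
- apply: leq_trans (_ : (size t <= n)%N); last by rewrite -ltnS.
  rewrite sz_t ltnS; apply/leq_sizeP => j; rewrite leq_eqVlt => /orP[/eqP<-|lt_j].
    by rewrite coefB coefZ coefXn eqxx mulr1 -uE subrr.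
  by rewrite coefB coefZ coefXn gtn_eqF // mulr0 subr0 nth_default // sz_t.
- rewrite /t1 mulrBr E mulrBl; congr (_ - _).
  by rewrite -!mul_polyC polyCM; ring.
exists (t' + u *: 'X^m).
by rewrite mulrDl -t'E /t1 -!mul_polyC polyCM; ring.
Qed.

Variable k : fieldType.
Local Notation K := {mpoly k[2]}.
Let X : K := 'X_[mon 1 0].
Let Y : K := 'X_[mon 0 1].
(** With x as inner and y as outer variable, polynomials in x are constants, and nonzero polynomials
    in y have a unit as leading coefficient; this is the situation of [dvd_of_unit_lead]. *)
Definition bivar : {rmorphism {poly {poly k}} -> K} :=
  poly_eval (poly_eval (@mpolyC 2 k) X) Y.

Lemma bivarE (p : {poly {poly k}}) : bivar p =
  \sum_(j < size p) \sum_(i < size p`_j) p`_j`_i *: 'X_[mon i j].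
Proof.
rewrite -{1}(coefK p) poly_def rmorph_sum; apply: eq_bigr => j _.
rewrite -mul_polyC rmorphM rmorphXn /bivar poly_evalC poly_evalX.
rewrite -{1}(coefK p`_j) poly_def rmorph_sum mulr_suml; apply: eq_bigr => i _.
rewrite -mul_polyC rmorphM rmorphXn poly_evalC poly_evalX.
by rewrite mul_mpolyC -scalerAl !XmonX XmonM !muln0 !muln1 addn0 add0n.
Qed.

Lemma bivar_coef p i j : (bivar p)@_(mon i j) = p`_j`_i.
Proof.
rewrite bivarE raddf_sum /=.
have coefij i' j' (b : k) : (b *: 'X_[mon i' j'] : K)@_(mon i j) =
    if (i' == i) && (j' == j) then b else 0.
  rewrite mcoeffZ mcoeffX; case: eqP => [/mon_inj[-> ->]|ne].
    by rewrite !eqxx mulr1.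
  rewrite mulr0; case: andP => // -[/eqP ei /eqP ej].
  by case: ne; rewrite ei ej.
have inner j' : (\sum_(i' < size p`_j') p`_j'`_i' *: 'X_[mon i' j'] : K)@_(mon i j) =
    if j' == j then p`_j`_i else 0.
  rewrite raddf_sum /= (eq_bigr _ (fun i' _ => coefij _ _ _)).
  case: eqP => [->|_]; last by apply: big1 => i' _; rewrite andbF.
  have [lt_i|ge_i] := ltnP i (size p`_j).
    rewrite (bigD1 (Ordinal lt_i)) //= eqxx big1 ?addr0 // => i' ni.
    by case: eqP => // ei; case/eqP: ni; apply: val_inj.
  rewrite (nth_default _ ge_i) big1 // => i' _; rewrite ltn_eqF //.
  exact: leq_trans (ltn_ord i') ge_i.
rewrite (eq_bigr _ (fun j' _ => inner _)).
have [lt_j|ge_j] := ltnP j (size p).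
  rewrite (bigD1 (Ordinal lt_j)) //= eqxx big1 ?addr0 // => j' nj.
  by case: eqP => // ej; case/eqP: nj; apply: val_inj.
rewrite (nth_default _ ge_j) coef0 big1 // => j' _; rewrite ltn_eqF //.
exact: leq_trans (ltn_ord j') ge_j.
Qed.

Lemma bivar_inj : injective bivar.
Proof.
by move=> p q E; apply/polyP => j; apply/polyP => i; rewrite -!bivar_coef E.
Qed.

Lemma bivar_surj (t : K) : exists p, bivar p = t.
Proof.
rewrite (mpolyE t).
apply: (big_ind (fun t => exists p, bivar p = t)) => [|_ _ [p <-] [q <-]|m _].
- by exists 0; rewrite rmorph0.
- by exists (p + q); rewrite rmorphD.
exists ((t@_m *: 'X^(m ord0))%:P * 'X^(m ord_max)).
rewrite [bivar _]rmorphM rmorphXn /bivar poly_evalC poly_evalX.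
rewrite -mul_polyC rmorphM rmorphXn poly_evalC poly_evalX.
by rewrite mul_mpolyC -scalerAl !XmonX XmonM !muln0 !muln1 addn0 add0n -monE.
Qed.

Lemma poly_eval_compX (A B : comNzRingType) (h : {rmorphism A -> B}) x n f :
  poly_eval h (x ^+ n) f = poly_eval h x (f \Po 'X^n).
Proof.
elim/poly_ind: f => [|f b IHf]; first by rewrite comp_poly0 !rmorph0.
rewrite comp_polyD comp_polyM comp_polyX comp_polyC !rmorphD !rmorphM /=.
by rewrite IHf !poly_evalC poly_evalX rmorphXn poly_evalX.
Qed.

Lemma separated_coprime d (f g : {poly k}) (t b : K) : (0 < d)%N -> f != 0 -> g != 0 ->
  poly_eval (@mpolyC 2 k) 'X_[mon 0 d] g * t =
    b * poly_eval (@mpolyC 2 k) 'X_[mon d 0] f ->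
  exists t', t = t' * poly_eval (@mpolyC 2 k) 'X_[mon d 0] f.
Proof.
move=> d0 f0 g0; have [T <-] := bivar_surj t; have [b' <-] := bivar_surj b.
have -> : 'X_[mon 0 d] = Y ^+ d by rewrite XmonX muln0 muln1.
have -> : 'X_[mon d 0] = X ^+ d by rewrite XmonX muln0 muln1.
rewrite (poly_eval_compX _ X d f) (poly_eval_compX _ Y d g).
set f1 := f \Po _; set g1 := g \Po _.
have fE : poly_eval (@mpolyC 2 k) X f1 = bivar f1%:P by rewrite /bivar poly_evalC.
have gE : poly_eval (@mpolyC 2 k) Y g1 = bivar (map_poly polyC g1).
  elim/poly_ind: g1 => [|h c IHh]; first by rewrite map_poly0 !rmorph0.
  rewrite !rmorphD !rmorphM /= map_polyX map_polyC /= IHh /bivar.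
  by rewrite !poly_evalX !poly_evalC.
rewrite fE gE -!rmorphM => /bivar_inj E.
have [|t' ->] := dvd_of_unit_lead _ E; last by exists (bivar t'); rewrite rmorphM.
rewrite lead_coef_map_inj ?rmorph0 //; last exact: polyC_inj.
rewrite poly_unitE size_polyC coefC eqxx unitfE lead_coef_eq0 comp_poly_eq0 ?g0 //.
by rewrite size_polyXn ltnS.
Qed.

End CohenMacaulay.

(** * The ring R at its maximal ideals *)

Section RingCohenMacaulay.
Local Open Scope classical_set_scope.
Local Open Scope ring_scope.

Variables (k : fieldType) (a d : nat).
Hypotheses (ha : (1 < a)%N) (had : (a < d)%N).
Local Notation K := {mpoly k[2]}.
Local Notation R := (Rring k a d).
Local Notation N := (size (generators k a d)).
Local Notation S := {mpoly k[N]}.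
Local Notation g := (in_tuple (generators k a d)).
Local Notation pi := (Rpi k a d).
Local Notation constR := (constR k a d).

Let d_gt0 : (0 < d)%N. Proof. by apply: leq_ltn_trans had. Qed.

Lemma noetherian_Rring : noetherian R.
Proof.
have [B [f [nB fi fs]]] := noetherian_adjoin constR [seq pi 'X_i | i <- enum 'I_N].
apply: noetherian_surj nB => r.
have [q qE] : exists q : S, r = pi q.
  have /asboolP[q qE] := subalg_valP r; exists q; apply: subalg_inj_inj.
  by rewrite subalg_injE qE.
rewrite {r}qE.
pose Q (q : S) := exists b, pi q = f b.
have QM p q1 : Q p -> Q q1 -> Q (p * q1).
  by move=> [b E] [b' E']; exists (b * b'); rewrite !rmorphM E E'.
rewrite (mpolyE q); apply: (big_ind Q) => [|p1 p2 [b E] [b' E']|m _].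
- by exists 0; rewrite !rmorph0.
- by exists (b + b'); rewrite !rmorphD E E'.
rewrite -mul_mpolyC; apply: (QM).
  by have [b E] := fi q@_m; exists b; rewrite E.
have Q1 : Q 1 by exists 1; rewrite !rmorph1.
rewrite mpolyXE_id; apply: (big_ind Q Q1 QM) => i _.
elim: (m i) => [|n IHn]; first by rewrite expr0.
rewrite exprS; apply: (QM) => //.
have [|b E] := fs (pi 'X_i); last by exists b; rewrite E.
by apply/mapP; exists i; rewrite ?mem_enum.
Qed.

Variables z w : R.
Hypothesis zE : subalg_inj z = 'X_[mon d 0].
Hypothesis wE : subalg_inj w = 'X_[mon 0 d].

Lemma monR_decomp al be (r : R) : in_semigroup a d al be ->
  subalg_inj r = 'X_[mon al be] ->
  exists p q v, r = z ^+ p * w ^+ q * baseR k ha had v.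
Proof.
move=> E rE; have [p [q [v hv]]] := semigroup_base_decomp k had E.
exists p, q, v; apply: subalg_inj_inj.
by rewrite !rmorphM !rmorphXn zE wE rE hv.
Qed.

(** The pair z', w' allows z and w to be exchanged, since each of them needs its own univariate
    relation. *)
Lemma baseR_span_poly (z' w' : R) :
  (forall p q, exists p' q', z ^+ p * w ^+ q = z' ^+ p' * w' ^+ q') ->
  forall r : R, exists b : 'I_d -> {poly {poly k}},
    r = \sum_v poly_eval (poly_eval constR z') w' (b v) * baseR k ha had v.
Proof.
move=> hzw r; apply: (monomials_ind ha had
  (Q := fun r => exists b : 'I_d -> {poly {poly k}},
     r = \sum_v poly_eval (poly_eval constR z') w' (b v) * baseR k ha had v)).
- by exists (fun=> 0); rewrite big1 // => v _; rewrite rmorph0 mul0r.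
- move=> _ _ [b ->] [b' ->]; exists (fun v => b v + b' v).
  by rewrite -big_split; apply: eq_bigr => v _; rewrite rmorphD mulrDl.
move=> b m r' _ E; rewrite [m]monE => rE; have [p [q [v ->]]] := monR_decomp E rE.
have [p' [q' ->]] := hzw p q.
exists (fun v' => if v' == v then (b *: 'X^p')%:P * 'X^q' else 0).
rewrite (bigD1 v) //= eqxx big1 ?addr0 => [|v' /negPf->]; last first.
  by rewrite rmorph0 mul0r.
rewrite rmorphM rmorphXn poly_evalC poly_evalX -mul_polyC rmorphM rmorphXn.
by rewrite poly_evalC poly_evalX !mulrA.
Qed.

Lemma maximal_relations (P : set R) : is_maximal P ->
  (exists2 f : {poly k}, f != 0 & P (poly_eval constR z f)) /\
  (exists2 f : {poly k}, f != 0 & P (poly_eval constR w f)).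
Proof.
move=> P_max; split.
  apply: (maximal_univariate_relation (w := w) (e := baseR k ha had) P_max).
  by apply: baseR_span_poly => p q; exists p, q.
apply: (maximal_univariate_relation (w := z) (e := baseR k ha had) P_max).
by apply: baseR_span_poly => p q; exists q, p; rewrite mulrC.
Qed.

Lemma poly_eval_subalg (r : R) f :
  subalg_inj (poly_eval constR r f) = poly_eval (@mpolyC 2 k) (subalg_inj r) f.
Proof. by apply: poly_eval_comp => b; rewrite constRE. Qed.

Lemma poly_eval_mon_neq0 i j f : (0 < i + j)%N -> f != 0 ->
  poly_eval (@mpolyC 2 k) 'X_[mon i j] f != 0.
Proof.
move=> ij0 f0.
have coefE n : (poly_eval (@mpolyC 2 k) 'X_[mon i j] f)@_(mon (n * i) (n * j)) = f`_n.
  rewrite -{1}(coefK f) poly_def rmorph_sum raddf_sum /=.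
  have term (m : 'I_(size f)) :
      (poly_eval (@mpolyC 2 k) 'X_[mon i j] (f`_m *: 'X^m))@_(mon (n * i) (n * j)) =
      if m == n :> nat then f`_n else 0.
    rewrite -mul_polyC rmorphM rmorphXn poly_evalC poly_evalX XmonX mcoeffCM mcoeffX.
    case: (m =P n :> nat) => [->|ne]; first by rewrite eqxx mulr1.
    case: eqP => [/mon_inj[e1 e2]|]; rewrite ?mulr0 //.
    case: ne; apply/eqP; rewrite -(eqn_pmul2r ij0) !mulnDr e1 e2.
    exact: eqxx.
  rewrite (eq_bigr _ (fun m _ => term m)).
  have [lt_n|ge_n] := ltnP n (size f).
    rewrite (bigD1 (Ordinal lt_n)) //= eqxx big1 ?addr0 // => m nm.
    by case: eqP => // em; case/eqP: nm; apply: val_inj.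
  rewrite (nth_default _ ge_n) big1 // => m _; rewrite ltn_eqF //.
  exact: leq_trans (ltn_ord m) ge_n.
apply: contraNneq f0 => E; apply/eqP/polyP => n.
by rewrite -coefE E mcoeff0 coef0.
Qed.

(* The semigroup condition on [(al, be)] is invariant under [be |-> be + d], so [R]
   is saturated in [k[x, y]] with respect to polynomials in [y^d]. *)
Lemma semigroup_supp_saturated (f : {poly k}) (t : K) : f != 0 ->
  semigroup_supp a d (poly_eval (@mpolyC 2 k) 'X_[mon 0 d] f * t) ->
  semigroup_supp a d t.
Proof.
set G := poly_eval _ _ f => f0 Gt; have G0 : G != 0 by apply: poly_eval_mon_neq0.
pose Gs (p : K) := forall m, m \in msupp p -> exists n, m = mon 0 (n * d).
have GsD p q : Gs p -> Gs q -> Gs (p + q).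
  by move=> hp hq m /msuppD_le; rewrite mem_cat => /orP[/hp|/hq].
have GsM p q : Gs p -> Gs q -> Gs (p * q).
  move=> hp hq m /msuppM_le/allpairsP[[m1 m2] /= [/hp[n ->] /hq[n' ->] ->]].
  by exists (n + n')%N; rewrite monD mulnDl.
have GsG : Gs G.
  rewrite /G; elim/poly_ind: f {f0 Gt G G0} => [|p b IHp].
    by rewrite rmorph0 => m; rewrite -mpolyC0 msupp0.
  rewrite rmorphD rmorphM /= poly_evalC poly_evalX; apply: GsD.
    apply: GsM => // m; rewrite msuppX inE => /eqP->.
    by exists 1%N; rewrite mul1n.
  move=> m; rewrite msuppC; case: ifP => // _; rewrite inE => /eqP->.
  by exists 0%N; rewrite mul0n /mon !mulm0n addm0.
have G_supp : semigroup_supp a d G.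
  apply/allP => m /GsG[n ->]; rewrite mon0 mon1.
  by apply/(in_semigroupP ha had); exists 0%N, n, 0%N; rewrite !addn0.
pose E (m : 'X_{1..2}) := in_semigroup a d (m ord0) (m ord_max).
(* [bad] collects the terms outside the semigroup. The leading monomial of [G * bad] is that of
   [bad] times a power of y^d, still outside the semigroup, so [bad] has to be 0. *)
pose good : K := \sum_(m <- msupp t | E m) t@_m *: 'X_[m].
pose bad : K := \sum_(m <- msupp t | ~~ E m) t@_m *: 'X_[m].
have tE : t = good + bad by rewrite {1}(mpolyE t) (bigID E).
have good_supp : semigroup_supp a d good.
  by apply: semigroup_supp_sum => m Em; apply: semigroup_suppZ; rewrite semigroup_suppX.
have Gbad : semigroup_supp a d (G * bad).
  have -> : G * bad = G * t - G * good by rewrite tE mulrDr addrC addKr.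
  by apply: semigroup_suppD => //; apply: semigroup_suppN; apply: semigroup_suppM.
have bad_supp m : m \in msupp bad -> ~~ E m.
  rewrite mcoeff_msupp /bad raddf_sum /=; apply: contraNN => Em.
  apply/eqP/big1 => m' nE; rewrite mcoeffZ mcoeffX; case: eqP => [e|_].
    by rewrite e Em in nE.
  by rewrite mulr0.
suff bad0 : bad = 0 by rewrite tE bad0 addr0.
apply/eqP; apply: contraT => bad0.
have Gbad0 : G * bad != 0 by rewrite mulf_neq0.
have := allP Gbad _ (mlead_supp Gbad0); rewrite /= mleadM //.
have [n ->] := GsG _ (mlead_supp G0).
rewrite [mlead bad]monE monD mon0 mon1 add0n [(n * d + _)%N]addnC => h.
have := bad_supp _ (mlead_supp bad0); rewrite /E -(in_semigroup_addy a n) ?h //.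
by case/andP: h => dv _; move: dv; rewrite addnA dvdn_addl // dvdn_mull.
Qed.

(** The quotient t' exists in k[x, y] by coprimality; f'(y^d) t' = b lies in R, so saturation puts
    t' in R. *)
Lemma separated_regular (f f' : {poly k}) (t b : R) : f != 0 -> f' != 0 ->
  poly_eval constR w f' * t = b * poly_eval constR z f ->
  exists b', t = b' * poly_eval constR z f.
Proof.
move=> f0 f'0 E; have := congr1 subalg_inj E.
rewrite !rmorphM !poly_eval_subalg zE wE => EK.
have [t' t'E] := separated_coprime d_gt0 f0 f'0 EK.
have F0 : poly_eval (@mpolyC 2 k) 'X_[mon d 0] f != 0.
  by apply: poly_eval_mon_neq0 => //; rewrite addn0.
have bE : poly_eval (@mpolyC 2 k) 'X_[mon 0 d] f' * t' = subalg_inj b.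
  by apply: (mulIf F0); rewrite -EK t'E mulrA.
have t'_mem : t' \in subalg_pred g.
  rewrite (subalgE ha had); apply: (semigroup_supp_saturated f'0).
  by rewrite bE; apply: (valR_supp ha had b).
exists (Subalg t'_mem); apply: subalg_inj_inj.
by rewrite rmorphM poly_eval_subalg zE [RHS]/(t' * _).
Qed.

Definition fracR : {rmorphism R -> {fraction K}} :=
  @FracField.tofrac K \o subalg_inj.

Lemma fracR_inj : injective fracR.
Proof.
move=> r s /= /eqP; rewrite tofrac_eq => /eqP; exact: subalg_inj_inj.
Qed.

Lemma fracR_alg_dep3 (x0 s0 x1 s1 x2 s2 : R) :
  fracR s0 != 0 -> fracR s1 != 0 -> fracR s2 != 0 ->
  alg_dep3 (fracR \o constR) (fracR x0 / fracR s0) (fracR x1 / fracR s1)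
    (fracR x2 / fracR s2).
Proof.
move=> h0 h1 h2.
have [q q0 qE] := @fraction_alg_dep3 k {fraction K} (@FracField.tofrac K)
  (subalg_inj x0) (subalg_inj s0) (subalg_inj x1) (subalg_inj s1) (subalg_inj x2)
  (subalg_inj s2) h0 h1 h2.
exists q => //; rewrite -[RHS]qE.
apply: (@poly_eval_comp _ _ _ _ _ idfun) => c1.
apply: (@poly_eval_comp _ _ _ _ _ idfun) => c2.
apply: (@poly_eval_comp _ _ _ _ _ idfun) => c3 /=.
by rewrite -(@constRE k a d).
Qed.

Theorem cohen_macaulay_Rring : cohen_macaulay R.
Proof.
split=> [|P P_max]; first exact: noetherian_Rring.
have P_prime := maximal_prime P_max.
have [[f f0 Pf] [f' f'0 Pf']] := maximal_relations P_max.
do 2!eexists; split; first exact: (loc_mapP fracR_inj P_prime).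
apply: (loc_cohen_macaulay fracR_inj P_prime fracR_alg_dep3 Pf Pf').
  move=> F0; have := poly_eval_mon_neq0 (i := d) (j := 0) _ f0.
  rewrite addn0 d_gt0 -zE -poly_eval_subalg F0 rmorph0 eqxx.
  by move/(_ isT).
by move=> t b; apply: separated_regular.
Qed.

End RingCohenMacaulay.

(** * The closed formula and the conclusion *)

Section Ceiling.
Local Open Scope ring_scope.

Lemma cdiv_ceil (a d : nat) : (1 < a)%N -> (a < d)%N ->
  Posz (cdiv d.-1 (d - a)) = Num.ceil ((d%:R - 1) / (d%:R - a%:R) : rat).
Proof.
move=> ha had; have c0 : (0 < d - a)%N by rewrite subn_gt0.
have c0' : (0 : rat) < (d - a)%:R by rewrite ltr0n.
have -> : d%:R - 1 = d.-1%:R :> rat.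
  by rewrite -{1}(prednK (n := d)) ?(leq_ltn_trans _ had) // -natr1 addrK.
rewrite -natrB 1?ltnW //; apply/esym/ceil_def.
set r := cdiv _ _.
(* Positivity makes the natural number [r.-1] agree with the integer r - 1 in the characterization
   of the ceiling. *)
have r0 : (0 < r)%N.
  rewrite lt0n; apply/eqP => r0; have := leqnn r.
  by rewrite {2}r0 cdiv_le // mul0n; lia.
have -> : r%:Z - 1 = (r.-1)%:Z by lia.
rewrite ltr_pdivlMr // ler_pdivrMr // -!pmulrn -!natrM ltr_nat ler_nat.
by rewrite ltnNge -!cdiv_le // -/r leqnn andbT -ltnNge prednK.
Qed.

End Ceiling.

Theorem theorem2p1 (k : fieldType) (a d : nat) (ha : 1 < a) (had : a < d) :
  cohen_macaulay (Rring k a d) /\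
  exists r : nat,
    [/\ regularity (Rpi k a d) (Posz r),
        reduction_number (@Qideal k a d) (@Rplus k a d) r &
        Posz r = Num.ceil ((d%:R - 1) / (d%:R - a%:R) : rat)%R].
Proof.
split; last first.
  exists (cdiv d.-1 (d - a)); split; [exact: regularity_Rring | | exact: cdiv_ceil].
  exact: reduction_number_Rring.
have [|z zE] := @exists_monR k a d ha had d 0.
  by apply/(in_semigroupP ha had); exists 1, 0, 0; split; lia.
have [|w wE] := @exists_monR k a d ha had 0 d.
  by apply/(in_semigroupP ha had); exists 0, 1, 0; split; lia.
exact: (cohen_macaulay_Rring ha had zE wE).
Qed.
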